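(* Let $(G_n)_{n\in\mathbb{N}}$ be a sequence of random directed graphs, $G_n$ having vertex set $[n]$. Consider the generalized PageRank $(R_i(n))_{i\in[n]}$, i.e. the solution of $$R_i(n)=\sum_{j\in[n]}\frac{C_j\,e_{j,i}}{d^{(\mathrm{out})}_j}R_j(n)+B_i,\qquad i\in[n],$$ where $(C_i)_{i\in[n]}$ are nonnegative random variables bounded by a constant $c<1$, and $(B_i)_{i\in[n]}$ is a vector of nonnegative random variables with $\mathbb{E}(B_i)=1-c$ that is independent of $G_n$. Let $V_n$ be a uniformly chosen vertex of $G_n$. Then: (a) Assume that $(C_i)_{i\in[n]}$ and $(B_i)_{i\in[n]}$ are each i.i.d. sequences, independent of each other and independent of $G_n$. If $G_n$ converges in distribution in the directed local weak sense, then there exists a random variable $R_\varnothing$ such that $R_{V_n}(n)\stackrel{d}{\to}R_\varnothing$. (b) Assume that $(C_i)_{i\in[n]}$ and $(B_i)_{i\in[n]}$ take discrete values, and equip each vertex $i$ of $G_n$ with the multi-mark $(d^{(\mathrm{out})}_i,C_i,B_i)$. Then: (b1) if the multi-marked graphs $G_n$ converge in distribution in the extended (multi-marked) directed local weak sense, then there exists a random variable $R_\varnothing$ with $\mathbb{E}[R_\varnothing]\le1$ such that $R_{V_n}(n)\stackrel{d}{\to}R_\varnothing$; (b2) if the multi-marked graphs $G_n$ converge in probability in the extended directed local weak sense, then there exists a random variable $R_\varnothing$ with $\mathbb{E}[R_\varnothing]\le1$ such that, for every $r>0$, $\frac1n\sum_{i\in[n]}\mathbf 1\{R_i(n)>r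\}\stackrel{\mathbb{P}}{\to}\mathbb{P}(R_\varnothing>r)$.
   Context: Here $e_{j,i}$ is the number of directed edges from $j$ to $i$ in $G_n$ and $d^{(\mathrm{out})}_j$ the out-degree of $j$; terms with $d^{(\mathrm{out})}_j=0$ (hence $e_{j,i}=0$) are read as $0$. The vertex $V_n$ is uniform on $[n]$, independently of everything else. In (a) the common distributions of $C_i$ and of $B_i$ do not depend on $n$. Rooted marked directed graphs. A rooted marked directed graph is a triple $(G,\varnothing,M(G))$, where $G$ is a directed multigraph (self-loops and multiple edges allowed) with finite or countable vertex set $V(G)$ and finite in- and out-degrees, $\varnothing\in V(G)$ is the root, and $M(G)=(m^{(\mathrm{out})}_i)_{i\in V(G)}$ are integers (marks) with $d^{(\mathrm{out})}_i\le m^{(\mathrm{out})}_i<\infty$. Two such objects are isomorphic ($\cong$) if there is a bijection of the vertex sets that preserves directed edges (with multiplicity), the root and the marks. For $k\ge0$, the $k$-neighborhood $U_{\le k}(\varnothing)$ is the rooted marked directed graph consisting of all vertices from which there is a directed path of length at most $k$ to $\varnothing$, all edges of $G$ between these vertices (for $k=0$: only $\varnothing$, no edges), root $\varnothing$, and marks inherited from $(G,\varnothing,M(G))$. Let $\mathcal{G}_\star$ be the set of isomorphism classes, and set $d_{loc}((G,\varnothing,M(G)),(G',\varnothing',M(G')))=1/(1+\kappa)$, where $\kappa=\inf\{k\ge1: U_{\le k}(\varnothing)\not\cong U_{\le k}(\varnothing')\}$ (distance $0$ if $\kappa=\infty$). Let $\tilde{\mathcal{G}}_\star$ be the quotient of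 $\mathcal{G}_\star$ identifying elements at distance $0$, on which $d_{loc}$ is a metric. Directed local weak (LW) convergence. For a finite marked directed graph $G_n$ put $\mathcal{P}_n=\frac{1}{|V(G_n)|}\sum_{i\in V(G_n)}\delta_{(G_n,i,M(G_n))}$. An unmarked directed graph is given marks equal to its out-degrees. For random $G_n$ and a probability $\mathcal{P}$ on $\tilde{\mathcal{G}}_\star$, $G_n$ converges to $\mathcal{P}$ in the LW sense: in distribution if $\mathbb{E}[\mathbb{E}_{\mathcal{P}_n}[f]]\to\mathbb{E}_{\mathcal{P}}[f]$; in probability if $\mathbb{E}_{\mathcal{P}_n}[f]\to\mathbb{E}_{\mathcal{P}}[f]$ in probability; in each case for every bounded continuous $f:\tilde{\mathcal{G}}_\star\to\mathbb{R}$. ''Converges'' means converges to some such $\mathcal{P}$. Extended directed LW convergence. It is defined in exactly the same way, with each mark $m^{(\mathrm{out})}_v$ replaced by a multi-mark $(m^{(\mathrm{out})}_v,C_v,B_v)$ with $C_v,B_v$ taking values in discrete sets; neighborhoods inherit multi-marks, and isomorphisms are required to preserve the whole multi-mark, i.e. also $C_{\gamma(v)}=C_v$ and $B_{\gamma(v)}=B_v$ for every vertex $v$.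
   Formalization: In (b2) the convergence in probability is stated only for those r>0 with P(R_∅ = r) = 0 (continuity points of the limit law); for every r>0 the claim is false, e.g. when the ranks decrease strictly to 1. *)

(* Defs.v *)
From HB Require Import structures.
From mathcomp Require Import all_boot all_order all_algebra finmap.
From mathcomp Require Import generic_quotient.
From mathcomp Require Import all_classical all_reals all_analysis.

Set Implicit Arguments.
Unset Strict Implicit.
Unset Printing Implicit Defensive.

Import Order.TTheory GRing.Theory Num.Theory.
Import numFieldNormedType.Exports.

Local Open Scope classical_set_scope.
Local Open Scope ring_scope.

(* A directed multigraph on V is given by its edge multiplicities:
   e i j is the number of edges from i to j. *)
Definition outdeg (V : choiceType) (e : V -> V -> nat) (i : V) : nat :=
  (\big[addn/0]_(j \in [set: V]) e i j)%N.

(* Graphs matter up to isomorphism only, and every finite or countable set is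
   in bijection with a subset of nat, so that vertices are natural numbers.
   The values of mark and xmark outside of the vertex set are junk.
   [mark] is the integer mark of a vertex, [xmark] is whatever else it carries:
   X is unit for marked graphs, and R * R (for C_v, B_v) for multi-marked
   graphs.  Isomorphisms compare marks by equality, i.e., X is seen as a
   discrete space, whatever its other structures. *)
Record mgraph (X : Type) := MGraph {
  vertex : set nat;
  mult : nat -> nat -> nat;
  root : nat;
  mark : nat -> nat;
  xmark : nat -> X;
  root_vertex : vertex root;
  mult_vertex : forall i j, mult i j != 0%N -> vertex i /\ vertex j;
  finite_out : forall i, finite_set [set j | mult i j != 0%N];
  finite_in : forall i, finite_set [set j | mult j i != 0%N];
  outdeg_mark : forall i, vertex i -> (outdeg mult i <= mark i)%N }.

Section isomorphism.
Context {X : Type}.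

Definition miso (G H : mgraph X) : Prop :=
  exists2 f : nat -> nat, set_bij (vertex G) (vertex H) f &
    [/\ {in vertex G &, forall i j, mult H (f i) (f j) = mult G i j},
        f (root G) = root H,
        {in vertex G, forall i, mark H (f i) = mark G i} &
        {in vertex G, forall i, xmark H (f i) = xmark G i}].

Lemma miso_refl G : miso G G.
Proof. by exists id; split => //= x Gx; exists x. Qed.

Lemma set_bij_inv (A B : set nat) (f : nat -> nat) : set_bij A B f ->
  exists2 g, set_bij B A g & {in A, cancel f g} /\ {in B, cancel g f}.
Proof.
move=> /[dup] bf [fAB fi fs].
have gK : {in B, cancel (pinv A f) f} by move=> y /set_mem/fs yB; apply: pinvK; exact/mem_set.
have fK : {in A, cancel f (pinv A f)} by move=> x xA; rewrite pinvKV.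
exists (pinv A f) => //; split.
- by move=> _ /fs[x Ax <-]; rewrite fK//; exact/mem_set.
- by move=> y z /gK {2}<- /gK {2}<- ->.
- by move=> x Ax; exists (f x); [exact: fAB|rewrite fK//; exact/mem_set].
Qed.

Lemma miso_sym G H : miso G H -> miso H G.
Proof.
move=> [f bf [fe fr fm fx]]; have [g bg [fK gK]] := set_bij_inv bf.
have gV i : i \in vertex H -> g i \in vertex G.
  by move=> /set_mem Hi; apply/mem_set; case: bg => gs _ _; exact: gs.
exists g => //; split => [i j iH jH||i iH|i iH].
- by rewrite -fe ?gV// !gK.
- by rewrite -fr fK//; exact/mem_set/root_vertex.
- by rewrite -fm ?gV// gK.
- by rewrite -fx ?gV// gK.
Qed.

Lemma miso_trans G H K : miso G H -> miso H K -> miso G K.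
Proof.
move=> [f bf [fe fr fm fx]] [g bg [ge gr gm gx]].
have fV i : i \in vertex G -> f i \in vertex H.
  by move=> /set_mem Gi; apply/mem_set; case: bf => fs _ _; exact: fs.
exists (g \o f); first exact: set_bij_comp bf bg.
split => [i j iG jG||i iG|i iG] /=.
- by rewrite ge ?fV// fe.
- by rewrite fr.
- by rewrite gm ?fV// fm.
- by rewrite gx ?fV// fx.
Qed.

End isomorphism.

Section neighborhood.
Context {X : Type} (k : nat) (G : mgraph X).

Definition nbhd_vertex : set nat := [set v |
  exists p : seq nat, [/\ path (fun i j => mult G i j != 0%N) v p,
    last v p = root G & (size p <= k)%N]].

(* For k = 0 the neighborhood has no edge, not even self-loops of the root. *)
Definition nbhd_mult (i j : nat) : nat :=
  if [&& (0 < k)%N, i \in nbhd_vertex & j \in nbhd_vertex]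
  then mult G i j else 0%N.

Lemma nbhd_root : nbhd_vertex (root G).
Proof. by exists [::]. Qed.

Lemma nbhd_mult_vertex i j :
  nbhd_mult i j != 0%N -> nbhd_vertex i /\ nbhd_vertex j.
Proof. by rewrite /nbhd_mult; case: ifP => // /and3P[_ /set_mem ? /set_mem ?]. Qed.

Lemma nbhd_mult_le i j : (nbhd_mult i j <= mult G i j)%N.
Proof. by rewrite /nbhd_mult; case: ifP. Qed.

Lemma finite_nbhd_out i : finite_set [set j | nbhd_mult i j != 0%N].
Proof.
apply: sub_finite_set (finite_out G i) => j /=.
by rewrite -!lt0n => /leq_trans; apply; exact: nbhd_mult_le.
Qed.

Lemma finite_nbhd_in i : finite_set [set j | nbhd_mult j i != 0%N].
Proof.
apply: sub_finite_set (finite_in G i) => j /=.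
by rewrite -!lt0n => /leq_trans; apply; exact: nbhd_mult_le.
Qed.

(* A vertex of the neighborhood is the root or the source of an edge. *)
Lemma nbhd_sub : nbhd_vertex `<=` vertex G.
Proof.
move=> v [[|w p] [/= + + _]]; first by move=> _ ->; exact: root_vertex.
by move=> /andP[/mult_vertex[]].
Qed.

Lemma nbhd_outdeg_mark i : nbhd_vertex i -> (outdeg nbhd_mult i <= mark G i)%N.
Proof.
move=> /nbhd_sub/outdeg_mark; apply: leq_trans.
rewrite /outdeg.
set s := finite_support _ _ (nbhd_mult i).
set t := finite_support _ _ (mult G i).
apply: (@leq_trans (\sum_(j <- s) mult G i j)%N).
  by apply: leq_sum => j _; exact: nbhd_mult_le.
apply: (uniq_sub_le_big leqnn (fun x y => leq_addr y x)).
- exact: finite_support_uniq.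
- exact: finite_support_uniq.
move=> j; rewrite /s in_finite_support; last first.
  by apply: sub_finite_set (finite_nbhd_out i) => k' [_ /eqP].
move=> /set_mem[_ /eqP]; rewrite -lt0n => h.
rewrite /t in_finite_support; last first.
  by apply: sub_finite_set (finite_out G i) => k' [_ /eqP].
apply/mem_set; split => //; apply/eqP; rewrite -lt0n.
exact: leq_trans h (nbhd_mult_le _ _).
Qed.

Definition nbhd : mgraph X :=
  @MGraph X nbhd_vertex nbhd_mult (root G) (mark G) (xmark G) nbhd_root
    nbhd_mult_vertex finite_nbhd_out finite_nbhd_in nbhd_outdeg_mark.

End neighborhood.

Section miso_nbhd.
Context {X : Type} (k : nat) (G H : mgraph X) (f : nat -> nat).
Hypothesis fGH : set_bij (vertex G) (vertex H) f.
Hypothesis fe : {in vertex G &, forall i j, mult H (f i) (f j) = mult G i j}.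
Hypothesis fr : f (root G) = root H.

Lemma nbhd_vertex_miso v : nbhd_vertex k G v -> nbhd_vertex k H (f v).
Proof.
move=> [p [pp lp sp]]; exists (map f p); split.
- rewrite path_map; apply: sub_path pp => i j /= ij.
  by have [iG jG] := mult_vertex ij; rewrite fe//; exact/mem_set.
- by rewrite last_map lp.
- by rewrite size_map.
Qed.

End miso_nbhd.

Lemma miso_nbhd {X : Type} (k : nat) (G H : mgraph X) :
  miso G H -> miso (nbhd k G) (nbhd k H).
Proof.
move=> GH; have [f bf [fe fr fm fx]] := GH.
have [g bg [fK gK]] := set_bij_inv bf.
have gV i : i \in vertex H -> g i \in vertex G.
  by move=> /set_mem Hi; apply/mem_set; case: bg => gs _ _; exact: gs.
have ge : {in vertex H &, forall i j, mult G (g i) (g j) = mult H i j}.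
  by move=> i j iH jH; rewrite -fe ?gV// !gK.
have gr : g (root H) = root G by rewrite -fr fK//; exact/mem_set/root_vertex.
have sG v : nbhd_vertex k G v -> v \in vertex G by move=> /nbhd_sub/mem_set.
have fN := nbhd_vertex_miso (k := k) fe fr.
have gN := nbhd_vertex_miso (k := k) ge gr.
exists f; split => /=.
- exact: fN.
- by move=> v w /set_mem/sG vG /set_mem/sG wG; rewrite -{2}(fK v)// -{2}(fK w)// => ->.
- move=> v vH; exists (g v); first exact: gN.
  by rewrite gK//; exact/mem_set/(nbhd_sub vH).
- move=> i j iG jG; rewrite /nbhd_mult iG jG fe; try by exact/sG/set_mem.
  by rewrite !(mem_set (fN _ (set_mem _))).
- exact: fr.
- by move=> i /set_mem/sG/fm.
- by move=> i /set_mem/sG/fx.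
Qed.

Section local_distance.
Context (R : realType) {X : Type}.
Implicit Types G H K : mgraph X.

Definition differ_at G H (k : nat) : bool :=
  (0 < k)%N && `[< ~ miso (nbhd k G) (nbhd k H) >].

Definition dloc G H : R :=
  if pselect (exists k, differ_at G H k) is left ex
  then (1 + (ex_minn ex)%:R)^-1 else 0.

Lemma dloc_ge0 G H : 0 <= dloc G H.
Proof. by rewrite /dloc; case: pselect => // ex; rewrite invr_ge0 addr_ge0. Qed.

Lemma dloc_eq0P G H :
  reflect (forall k, (0 < k)%N -> miso (nbhd k G) (nbhd k H))
          (dloc G H == 0).
Proof.
rewrite /dloc; case: pselect => [ex|nex].
  rewrite invr_eq0 gt_eqF; last by rewrite ltr_wpDr.
  apply: ReflectF => h; case: ex => k /andP[k0 /asboolP]; apply; exact: h.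
rewrite eqxx; apply: ReflectT => k k0; apply: contrapT => nk; apply: nex.
by exists k; rewrite /differ_at k0; apply/asboolP.
Qed.

(* Isomorphic graphs are at distance 0, so that quotienting mgraph by
   "distance 0" also performs the quotient by isomorphism. *)
Lemma miso_dloc G H : miso G H -> dloc G H = 0.
Proof. by move=> GH; apply/eqP/dloc_eq0P => k _; exact: miso_nbhd. Qed.

Lemma dlocxx G : dloc G G = 0.
Proof. exact/miso_dloc/miso_refl. Qed.

Lemma dloc_sym G H : dloc G H = dloc H G.
Proof.
suff -> : (dloc G H = if pselect (exists k, differ_at H G k) is left ex
  then (1 + (ex_minn ex)%:R)^-1 else 0) by [].
rewrite /dloc; suff -> : differ_at G H = differ_at H G by [].
apply/funext => k; congr (_ && _); apply: asbool_equiv_eq.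
by split => h /miso_sym.
Qed.

Lemma dloc_max G H K : dloc G K <= dloc G H \/ dloc G K <= dloc H K.
Proof.
rewrite {1 3}/dloc; case: pselect => [ex|_]; last by left; exact: dloc_ge0.
case: ex_minnP => k /andP[k0 /asboolP nGK] _.
have ub G' H' : differ_at G' H' k -> (1 + k%:R)^-1 <= dloc G' H'.
  move=> d; rewrite /dloc; case: pselect => [ex'|]; last by case; exists k.
  case: ex_minnP => m _ /(_ _ d) mk.
  by rewrite lef_pV2 ?posrE ?ltr_wpDr// lerD2l ler_nat.
have [/ub|nHK] := boolP (differ_at H K k); first by right.
have [/ub|nGH] := boolP (differ_at G H k); first by left.
exfalso; apply: nGK; move: nHK nGH; rewrite /differ_at k0 /=.
move=> /asboolPn/contrapT HK /asboolPn/contrapT GH; exact: miso_trans GH HK.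
Qed.

Lemma dloc_triangle H G K : dloc G K <= dloc G H + dloc H K.
Proof.
have [/le_trans->//|/le_trans->//] := dloc_max G H K.
- by rewrite lerDl dloc_ge0.
- by rewrite lerDr dloc_ge0.
Qed.

End local_distance.

HB.instance Definition _ (X : Type) := gen_eqMixin (mgraph X).
HB.instance Definition _ (X : Type) := gen_choiceMixin (mgraph X).

Section lwspace.
Context (R : realType) (X : pointedType).

Definition dist0 : rel (mgraph X) := fun G H => dloc R G H == 0.

Lemma dist0_refl : reflexive dist0.
Proof. by move=> G; apply/eqP; exact: dlocxx. Qed.

Lemma dist0_sym : symmetric dist0.
Proof. by move=> G H; rewrite /dist0 dloc_sym. Qed.

Lemma dist0_trans : transitive dist0.
Proof.
move=> H G K /eqP GH /eqP HK; rewrite /dist0 eq_le dloc_ge0 andbT.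
by rewrite (le_trans (dloc_triangle R H G K))// GH HK addr0.
Qed.

Canonical dist0_equiv := EquivRel dist0 dist0_refl dist0_sym dist0_trans.
Canonical dist0_encModRel := defaultEncModRel dist0.

Definition lwspace : Type := {eq_quot dist0}%qT.
HB.instance Definition _ := Choice.on lwspace.

Definition lwclass (G : mgraph X) : lwspace := \pi_({eq_quot dist0})%qT G.

Definition lwrepr (x : lwspace) : mgraph X :=
  repr (x : {eq_quot dist0}%qT).

Definition lwdist (x y : lwspace) : R := dloc R (lwrepr x) (lwrepr y).

Lemma lwclassK x : lwclass (lwrepr x) = x.
Proof. exact: reprK. Qed.

Lemma lwclassP G H : lwclass G = lwclass H <-> dloc R G H = 0.
Proof.
split=> [GH|/eqP GH].
  by apply/eqP; change (dist0_equiv G H); apply/eqmodP.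
by apply/eqmodP.
Qed.

Lemma lwreprK G : dloc R (lwrepr (lwclass G)) G = 0.
Proof. by apply/lwclassP; rewrite lwclassK. Qed.

Lemma lwdistE G H : lwdist (lwclass G) (lwclass H) = dloc R G H.
Proof.
apply/eqP; rewrite eq_le; apply/andP; split.
- rewrite (le_trans (dloc_triangle R G _ _))// lwreprK add0r.
  by rewrite (le_trans (dloc_triangle R H _ _))// [dloc _ H _]dloc_sym lwreprK addr0.
- rewrite (le_trans (dloc_triangle R (lwrepr (lwclass G)) _ _))//.
  rewrite dloc_sym lwreprK add0r.
  by rewrite (le_trans (dloc_triangle R (lwrepr (lwclass H)) _ _))// lwreprK addr0.
Qed.

Lemma lwdistxx x : lwdist x x = 0. Proof. exact: dlocxx. Qed.

Lemma lwdist_positivity x y : lwdist x y = 0 -> x = y.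
Proof. by move=> /lwclassP; rewrite !lwclassK. Qed.

Lemma lwdist_sym x y : lwdist x y = lwdist y x.
Proof. exact: dloc_sym. Qed.

Lemma lwdist_triangle y x z : lwdist x z <= lwdist x y + lwdist y z.
Proof. exact: dloc_triangle. Qed.

HB.instance Definition _ := isMetric.Build R lwspace
  lwdistxx lwdist_positivity lwdist_sym lwdist_triangle.

End lwspace.

Section finite_graph.
Context (X : pointedType) (n : nat).

Definition ord_mult (e : 'I_n -> 'I_n -> nat) (i j : nat) : nat :=
  match insub i, insub j with Some i', Some j' => e i' j' | _, _ => 0%N end.

Context (e : 'I_n -> 'I_n -> nat) (x : 'I_n -> X) (v : 'I_n).

Let V : set nat := [set i | (i < n)%N].

Lemma ord_mult_vertex i j : ord_mult e i j != 0%N -> V i /\ V j.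
Proof.
rewrite /ord_mult; case: insubP => [i' ? _|_]; last by rewrite eqxx.
by case: insubP => [j' ? _|_]; last by rewrite eqxx.
Qed.

Lemma finite_ord_out i : finite_set [set j | ord_mult e i j != 0%N].
Proof. by apply: sub_finite_set (finite_II n) => j /ord_mult_vertex[]. Qed.

Lemma finite_ord_in i : finite_set [set j | ord_mult e j i != 0%N].
Proof. by apply: sub_finite_set (finite_II n) => j /ord_mult_vertex[]. Qed.

(* The graph on {0, ..., n - 1} with edges e, rooted at v, whose integer marks
   are the out-degrees. *)
Definition ord_mgraph : mgraph X :=
  @MGraph X V (ord_mult e) v (outdeg (ord_mult e))
    (fun i => oapp x point (insub i)) (ltn_ord v) ord_mult_vertex
    finite_ord_out finite_ord_in (fun _ _ => leqnn _).

Lemma ord_multE (i j : 'I_n) : ord_mult e i j = e i j.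
Proof. by rewrite /ord_mult !valK. Qed.

Lemma outdeg_ord (i : 'I_n) : outdeg (ord_mult e) i = (\sum_(j < n) e i j)%N.
Proof.
rewrite /outdeg; set s := finite_support _ _ _.
have sP (j : nat) : (j \in s) = (ord_mult e i j != 0%N).
  rewrite /s in_finite_support; last first.
    by apply: sub_finite_set (finite_ord_out i) => k' [_ /eqP].
  by apply/idP/idP => [/set_mem[_ /eqP]//|h]; apply/mem_set; split => //; apply/eqP.
transitivity (\sum_(j <- iota 0 n) ord_mult e i j)%N.
  rewrite [RHS](bigID (mem s)) /= [X in (_ + X)%N]big1 ?addn0; last first.
    by move=> j; rewrite sP negbK => /eqP.
  rewrite -[RHS]big_filter; apply: perm_big.
  apply: uniq_perm => [||j].
  - exact: finite_support_uniq.
  - exact/filter_uniq/iota_uniq.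
  - rewrite mem_filter mem_iota add0n /=; case: (boolP (j \in s)) => //.
    by rewrite sP => /ord_mult_vertex[_ ->].
rewrite -[n in iota 0 n]subn0 -/(index_iota 0 n) big_mkord.
by apply: eq_bigr => j _; rewrite ord_multE.
Qed.

End finite_graph.

HB.instance Definition _ (R : realType) (X : pointedType) :=
  isPointed.Build (lwspace R X)
    (lwclass R (@ord_mgraph X 1 (fun _ _ => 0%N) (fun=> point) ord0)).

Section independence.
Context d (T : measurableType d) (R : realType) (P : probability T R).

Definition independent (F G : set_system T) : Prop :=
  forall A B, F A -> G B -> P (A `&` B) = (P A * P B)%E.

Definition mutually_independent (I : choiceType) (F : I -> set_system T) :
    Prop :=
  forall (J : {fset I}) (A : I -> set T), (forall i, i \in J -> F i (A i)) ->
    P (\bigcap_(i in [set` J]) A i) = (\prod_(i <- J) P (A i))%E.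

Definition sigma_rv (d' : measure_display) (T' : measurableType d') (I : Type)
    (X : I -> T -> T') : set_system T :=
  <<s \bigcup_i preimage_set_system [set: T] (X i) measurable >>.

End independence.

Section convergence.
Context (R : realType) (d : nat -> measure_display)
  (T : forall n, measurableType (d n)) (P : forall n, probability (T n) R).

Definition cvg_in_distribution (Y : forall n, T n -> R)
    (d' : measure_display) (T' : measurableType d') (P' : probability T' R)
    (Z : T' -> R) : Prop :=
  forall h : R -> R, continuous h -> bounded_fun h ->
    ('E_(P n)[h \o Y n])%E @[n --> \oo] --> ('E_P'[h \o Z])%E.

Definition cvg_in_probability (Y : forall n, T n -> R) (l : R) : Prop :=
  forall eps : R, 0 < eps ->
    P n [set w | eps < `|Y n w - l|] @[n --> \oo] --> 0%E.

(* The rows are i.i.d., with the same law in all the rows. *)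
Definition iid_array (Y : forall n, 'I_n.+1 -> T n -> R) : Prop :=
  (forall n, mutually_independent (P n)
     (fun i => preimage_set_system [set: T n] (Y n i) measurable)) /\
  (forall n m i j (A : set R), measurable A ->
     P n (Y n i @^-1` A) = P m (Y m j @^-1` A)).

Context (X : pointedType).

Definition lwborel := g_sigma_algebraType (@open (lwspace R X)).

(* The n-th graph has vertex set 'I_n.+1; g n w v is the class of the n-th
   graph rooted at v, and [root_mean] is the expectation under P_n. *)
Definition root_mean (n : nat) (f : lwspace R X -> R)
    (g : 'I_n.+1 -> lwspace R X) : R :=
  n.+1%:R^-1 * \sum_(v < n.+1) f (g v).

Definition lw_cvg_in_distribution
    (g : forall n, T n -> 'I_n.+1 -> lwspace R X) : Prop :=
  exists mu : probability lwborel R,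
    forall f : lwspace R X -> R, continuous f -> bounded_fun f ->
      ('E_(P n)[fun w => root_mean f (g n w)])%E @[n --> \oo] --> ('E_mu[f])%E.

Definition lw_cvg_in_probability
    (g : forall n, T n -> 'I_n.+1 -> lwspace R X) : Prop :=
  exists mu : probability lwborel R,
    forall f : lwspace R X -> R, continuous f -> bounded_fun f ->
      cvg_in_probability (fun n w => root_mean f (g n w)) (fine ('E_mu[f])%E).

End convergence.

(* A null out-degree contributes 0, since x / 0 = 0. *)
Definition is_pagerank (R : realType) (n : nat) (e : 'I_n -> 'I_n -> nat)
    (C B PR : 'I_n -> R) : Prop :=
  forall i, PR i =
    \sum_(j < n) C j * (e j i)%:R / (\sum_(k < n) e j k)%:R * PR j + B i.

(* Main.v *)
Require Import Defs.
From HB Require Import structures.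
From mathcomp Require Import all_boot all_order all_algebra finmap.
From mathcomp Require Import all_classical all_reals all_analysis.
From mathcomp Require Import measurable_realfun lra ring.

Set Implicit Arguments.
Unset Strict Implicit.
Unset Printing Implicit Defensive.

Import Order.TTheory GRing.Theory Num.Theory.
Import numFieldNormedType.Exports.

Local Open Scope classical_set_scope.
Local Open Scope ring_scope.

(** Let T_N(v) be the N-th iterate, started from 0, of the pagerank equation at
    the vertex v.  Two facts carry the proof.

    The error is small on average, whatever the in-degrees.  The weights that a
    vertex sends along its out-edges sum to at most c, so that the equation is
    a contraction of ratio c in the l1 norm; as the B_i have mean 1 - c, the mean
    of R - T_N at a uniform vertex is at most c^N ([sum_pr_iter_error],
    [l1_mean]), uniformly in n.

    T_N is local: T_N(v) is read off the (N+1)-neighborhood of v with its marks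
    ([mg_iter_local]), and a function of a neighborhood of fixed radius is
    locally constant, hence continuous, for the local distance
    ([local_continuous]).  If the graphs carry the marks C and B, then phi(T_N)
    is itself a test function for the local weak convergence, for every bounded
    phi.  If C and B are i.i.d. and independent of the graph, then the test
    function is the mean of phi(T_N) over the marks with the graph frozen
    ([quenched_mean]): finite i.i.d. families have a joint law that does not
    depend on their labels, so that this mean depends on the neighborhood up to
    isomorphism only ([quenched_mean_local]).

    Hence E phi(R_(V_n)) converges for every Lipschitz phi, being uniformly close
    to convergent sequences.  It suffices to use for phi the ramps, Lipschitz
    versions of the indicators of half-lines: since E R_(V_n) <= 1 gives
    tightness, the limits of the means of the ramps define the distribution
    function of a random variable Z >= 0 with E Z <= 1, to which R_(V_n) converges
    in distribution ([ramp_limit_representation],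
    [cvg_ramps_in_distribution]).  When the graphs converge in probability, the
    empirical means of ramps converge in probability to their means under Z, and
    the indicator of ]r, +oo[ lies between two of them whose means under Z are
    close as soon as Z has no atom at r ([rank_tail_in_probability]). *)

(** * Ramps and means of bounded random variables *)

Section ramp.
Context {R : realType}.
Implicit Types x d y z t : R.

(** Lipschitz substitute for the indicator of ]-oo, x], with slope on [x, x + d]. *)
Definition ramp x d y : R := Num.max 0 (Num.min 1 ((x + d - y) / d)).

Lemma ramp_ge0 x d y : 0 <= ramp x d y.
Proof. by rewrite /ramp le_max lexx. Qed.

Lemma ramp_le1 x d y : ramp x d y <= 1.
Proof. by rewrite /ramp ge_max ler01 ge_min lexx. Qed.

Lemma ramp_norm x d y : `|ramp x d y| <= 1.
Proof. by rewrite ger0_norm ?ramp_ge0 ?ramp_le1. Qed.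

Lemma ramp1 x d y : 0 < d -> y <= x -> ramp x d y = 1.
Proof.
move=> d0 yx; rewrite /ramp min_l; last by rewrite ler_pdivlMr//; lra.
by rewrite max_r.
Qed.

Lemma ramp0 x d y : 0 < d -> x + d <= y -> ramp x d y = 0.
Proof.
move=> d0 yx; rewrite /ramp max_l// ge_min; apply/orP; right.
by rewrite ler_pdivrMr// mul0r; lra.
Qed.

Lemma clamp_le s s' : s <= s' ->
  Num.max 0 (Num.min 1 s) <= Num.max 0 (Num.min 1 s') :> R.
Proof.
by move=> ss'; case: (leP 1 s) => ?; case: (leP 1 s') => ?;
  case: (leP 0 s) => ?; case: (leP 0 s') => ?; rewrite ?(max_r ler01); lra.
Qed.

Lemma clamp_lip s s' : s <= s' ->
  Num.max 0 (Num.min 1 s') <= Num.max 0 (Num.min 1 s) + (s' - s) :> R.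
Proof.
by move=> ss'; case: (leP 1 s) => ?; case: (leP 1 s') => ?;
  case: (leP 0 s) => ?; case: (leP 0 s') => ?; rewrite ?(max_r ler01); lra.
Qed.

Lemma ramp_anti x d y z : 0 < d -> y <= z -> ramp x d z <= ramp x d y.
Proof. by move=> d0 yz; apply: clamp_le; rewrite ler_pM2r ?invr_gt0//; lra. Qed.

Lemma ramp_lip x d y z : 0 < d -> y <= z ->
  ramp x d y <= ramp x d z + (z - y) / d.
Proof.
move=> d0 yz; have -> : (z - y) / d = (x + d - y) / d - (x + d - z) / d.
  by rewrite -mulrBl; congr (_ / _); lra.
by apply: clamp_lip; rewrite ler_pM2r ?invr_gt0//; lra.
Qed.

Lemma ramp_shift x d y t : ramp (x + t) d (y + t) = ramp x d y.
Proof. by rewrite /ramp; congr (Num.max _ (Num.min _ (_ / _))); lra. Qed.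

Lemma measurable_ramp x d : measurable_fun [set: R] (ramp x d).
Proof.
apply: measurable_maxr => //; apply: measurable_minr => //.
by apply: measurable_funM => //; apply: measurable_funB.
Qed.

Lemma sum_clamp (m : nat) (s : R) :
  \sum_(j < m) Num.max 0 (Num.min 1 (s + j.+1%:R)) =
  Num.max 0 (Num.min m%:R (s + m%:R)).
Proof.
elim: m => [|m IH].
  by rewrite big_ord0 addr0; case: (leP 0 s) => ?; rewrite ?maxxx// max_l ?ltW.
rewrite big_ord_recr /= IH -!natr1.
have : (0 : R) <= m%:R by rewrite ler0n.
move=> m0; case: (leP m%:R (s + m%:R)) => ?;
  case: (leP 1 (s + (m%:R + 1))) => ?; case: (leP (m%:R + 1) (s + (m%:R + 1))) => ?;
  case: (leP 0 (s + m%:R)) => ?; case: (leP 0 (s + (m%:R + 1))) => ?;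
  rewrite ?(max_r ler01) ?(max_r m0) ?max_r; lra.
Qed.

(** A ramp is the average of the ramps over the pieces of a regular subdivision
    of its slope: this is what makes its mean computable from a distribution
    function. *)
Lemma ramp_subdivision x d y (m : nat) : 0 < d ->
  \sum_(j < m.+1) ramp (x + j%:R * (d / m.+1%:R)) (d / m.+1%:R) y =
  m.+1%:R * ramp x d y.
Proof.
move=> d0; set M : R := m.+1%:R; have M0 : 0 < M by rewrite ltr0n.
have dM0 : 0 < d / M by rewrite divr_gt0.
under eq_bigr => j _.
  rewrite /ramp (_ : _ / _ = (x - y) / (d / M) + j.+1%:R); last first.
    by rewrite -natr1; field; rewrite !gt_eqF.
  over.
rewrite sum_clamp -/M /ramp maxr_pMr ?ltW// minr_pMr ?ltW// mulr0 mulr1.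
by congr (Num.max _ (Num.min _ _)); field; rewrite !gt_eqF.
Qed.

End ramp.

(** The differences of consecutive ramps are tents centered at the nodes i d;
    on the nonnegative half-line they form a partition of unity up to m d. *)
Lemma telescope_ramp (R : realType) (d y : R) (m : nat) : 0 < d -> 0 <= y ->
  \sum_(i < m.+1) (ramp (i%:R * d) d y - ramp (i%:R * d - d) d y) =
  ramp (m%:R * d) d y.
Proof.
move=> d0 y0; elim: m => [|m IH].
  by rewrite big_ord1 mul0r sub0r [X in _ - X]ramp0 ?subr0 ?addNr.
rewrite big_ord_recr /= IH (_ : m.+1%:R * d - d = m%:R * d); last first.
  by rewrite -natr1; ring.
by ring.
Qed.

Section bounded_mean.
Context d (T : measurableType d) (R : realType) (P : probability T R).
Implicit Types f g : T -> R.

Lemma bounded_integrable f M : measurable_fun [set: T] f ->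
  (forall w, `|f w| <= M) -> P.-integrable [set: T] (EFin \o f).
Proof.
move=> mf fM; apply: measurable_bounded_integrable => //.
  by rewrite (le_lt_trans (probability_le1 P _))// ltry.
exists M; split; first exact: num_real.
by move=> x Mx w _; exact: le_trans (fM w) (ltW Mx).
Qed.

Lemma integrable_cst (k : R) : P.-integrable [set: T] (EFin \o cst k).
Proof. exact: (@bounded_integrable _ `|k|). Qed.

Lemma Rintegral_prob_cst (k : R) : \int[P]_w k = k.
Proof.
rewrite Rintegral_cst// (_ : fine _ = 1) ?mulr1//.
exact: (congr1 fine (probability_setT P)).
Qed.

Lemma ge0_expectation_integrable f : measurable_fun [set: T] f ->
  (forall w, 0 <= f w) -> ('E_P[f] <= 1)%E -> P.-integrable [set: T] (EFin \o f).
Proof.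
move=> mf f0 Ef; apply/integrableP; split; first exact/measurable_EFinP.
apply: le_lt_trans (ltry 1); move: Ef; rewrite unlock; apply: le_trans.
rewrite le_eqVlt; apply/orP; left; apply/eqP; apply: eq_integral => w _ /=.
by rewrite ger0_norm.
Qed.

Lemma expectation_Rintegral f : P.-integrable [set: T] (EFin \o f) ->
  ('E_P[f] = (\int[P]_w f w)%:E)%E.
Proof. by move=> ?; rewrite unlock fineK//; exact: integrable_fin_num. Qed.

Lemma integrable_ramp f (x e : R) : measurable_fun [set: T] f ->
  P.-integrable [set: T] (EFin \o (fun w => ramp x e (f w))).
Proof.
move=> mf; apply: (@bounded_integrable _ 1) => [|w]; last exact: ramp_norm.
exact: measurableT_comp (measurable_ramp x e) mf.
Qed.

Lemma Rintegral_sum (I : Type) (s : seq I) (h : I -> T -> R) :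
  (forall i, P.-integrable [set: T] (EFin \o h i)) ->
  \int[P]_w (\sum_(i <- s) h i w) = \sum_(i <- s) \int[P]_w h i w.
Proof.
move=> ih; elim: s => [|i s IH].
  rewrite big_nil -[RHS](@Rintegral_set0 _ _ _ P (cst 0)).
  by under eq_Rintegral do rewrite big_nil; rewrite Rintegral_cst// mul0r
    Rintegral_set0.
rewrite big_cons -IH -RintegralD//; last first.
  apply: eq_integrable (@integrable_sum _ _ _ P _ measurableT _ s xpredT
    (fun i => EFin \o h i) _) => // w _ /=.
  by rewrite sumEFin.
by apply: eq_Rintegral => w _; rewrite big_cons.
Qed.

Lemma integrable_sumr (I : Type) (s : seq I) (k : R) (h : I -> T -> R) :
  (forall i, P.-integrable [set: T] (EFin \o h i)) ->
  P.-integrable [set: T] (EFin \o (fun w => k * \sum_(i <- s) h i w)).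
Proof.
move=> ih; apply: (integrableZl measurableT k (f := EFin \o (fun w => \sum_(i
  <- s) h i w))).
apply: eq_integrable (@integrable_sum _ _ _ P _ measurableT _ s xpredT
  (fun i => EFin \o h i) _) => // w _ /=.
by rewrite sumEFin.
Qed.

Lemma Rintegral_sumr (I : Type) (s : seq I) (k : R) (h : I -> T -> R) :
  (forall i, P.-integrable [set: T] (EFin \o h i)) ->
  \int[P]_w (k * \sum_(i <- s) h i w) = k * \sum_(i <- s) \int[P]_w h i w.
Proof.
move=> ih; rewrite RintegralZl ?Rintegral_sum//.
have := @integrable_sumr _ s 1 h ih; apply: eq_integrable => // w _ /=.
by rewrite mul1r.
Qed.

Lemma Rintegral_le1 f : measurable_fun [set: T] f ->
  (forall w, 0 <= f w <= 1) -> 0 <= \int[P]_w f w <= 1.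
Proof.
move=> mf f01; apply/andP; split.
  by apply: Rintegral_ge0 => w _; case/andP: (f01 w).
rewrite -[leRHS]Rintegral_prob_cst.
apply: le_Rintegral => //.
- apply: (@bounded_integrable _ 1) => // w.
  by case/andP: (f01 w) => ? ?; rewrite ger0_norm.
- exact: integrable_cst.
- by move=> w _; case/andP: (f01 w).
Qed.

Lemma ramp_mean_cdf f (x e : R) : measurable_fun [set: T] f -> 0 < e ->
  fine (P [set w | f w <= x]) <= \int[P]_w ramp x e (f w) <=
  fine (P [set w | f w <= x + e]).
Proof.
move=> mf e0.
have mE y : measurable [set w | f w <= y].
  have -> : [set w | f w <= y] = f @^-1` `]-oo, y].
    by apply/seteqP; split => w /=; rewrite in_itv.
  by rewrite -[_ @^-1` _]setTI; exact: mf.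
have iE y : fine (P [set w | f w <= y]) =
    \int[P]_w \1_[set w | f w <= y] w.
  by rewrite /Rintegral integral_indic// setIT.
have intE y : P.-integrable [set: T] (EFin \o \1_[set w | f w <= y]).
  apply: (@bounded_integrable _ 1) => [|w]; first exact: measurable_indic.
  by rewrite indicE ger0_norm ?ler0n//; case: (_ \in _).
rewrite !iE; apply/andP; split; apply: le_Rintegral => //;
  try exact: integrable_ramp.
- move=> w _; rewrite indicE; have [|_] := boolP (_ \in _); last exact: ramp_ge0.
  by rewrite inE /= => fx; rewrite ramp1.
- move=> w _; rewrite indicE; have [_|] := boolP (_ \in _); first exact: ramp_le1.
  by move/negP; rewrite inE /= => /negP; rewrite -ltNge => /ltW fx; rewrite ramp0.
Qed.

(** For nonnegative numbers the truncation at K is an affine function of a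
    ramp, so that the limits of the means of ramps control truncated means. *)
Lemma Rintegral_min f (K : R) : measurable_fun [set: T] f ->
  (forall w, 0 <= f w) -> 0 < K ->
  \int[P]_w Num.min (f w) K = K * (1 - \int[P]_w ramp 0 K (f w)).
Proof.
move=> mf f0 K0; have ir := integrable_ramp 0 K mf.
have im : P.-integrable [set: T] (EFin \o (fun w => 1 - ramp 0 K (f w))).
  exact: eq_integrable (integrableB measurableT (integrable_cst 1) ir).
transitivity (\int[P]_w (K * (1 - ramp 0 K (f w)))).
  apply: eq_Rintegral => w _; have [fK|/ltW Kf] := leP (f w) K.
    have fw0 := f0 w; rewrite /ramp add0r min_r; last by rewrite ler_pdivrMr//; lra.
    rewrite max_r; last by rewrite divr_ge0 ?subr_ge0// ltW.
    by field; rewrite gt_eqF.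
  by rewrite ramp0 ?subr0 ?mulr1// add0r.
rewrite RintegralZl// RintegralB//; last exact: integrable_cst.
by rewrite Rintegral_prob_cst.
Qed.

(** Monotone convergence of the truncations at 1, 2, 3, and so on. *)
Lemma expectation_le1_of_min f : measurable_fun [set: T] f ->
  (forall w, 0 <= f w) ->
  (forall k : nat, \int[P]_w Num.min (f w) k.+1%:R <= 1) -> ('E_P[f] <= 1)%E.
Proof.
move=> mf f0 fK; rewrite unlock.
have mm (k : nat) : measurable_fun [set: T] (fun w => (Num.min (f w) k.+1%:R)%:E).
  by apply/measurable_EFinP; apply: measurable_minr.
have m0 (k : nat) w : [set: T] w -> (0 <= (Num.min (f w) k.+1%:R)%:E)%E.
  by move=> _; rewrite lee_fin le_min f0 ler0n.
have mh w : [set: T] w ->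
    nondecreasing_seq (fun k => (Num.min (f w) k.+1%:R)%:E).
  move=> _ k1 k2 k12; rewrite lee_fin le_min !ge_min lexx/=; apply/orP; right.
  by rewrite ler_nat.
have -> : (\int[P]_w (f w)%:E =
    \int[P]_w limn (fun k => (Num.min (f w) k.+1%:R)%:E))%E.
  apply: eq_integral => w _; apply/esym/cvg_lim => //.
  apply: cvg_near_cst; near=> k; rewrite min_l//.
  apply: (@le_trans _ _ k%:R); last by rewrite ler_nat.
  by near: k; exact: nbhs_infty_ger.
rewrite monotone_convergence//; apply: lime_le.
  apply: ereal_nondecreasing_is_cvgn => k1 k2 k12; apply: ge0_le_integral => //.
    by move=> w wT; exact: m0.
  by move=> w wT; exact: (mh w wT _ _ k12).
apply: nearW => k; move: (fK k).
rewrite /Rintegral -lee_fin fineK//; apply: integrable_fin_num => //.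
apply: (@bounded_integrable _ k.+1%:R); first exact: measurable_minr.
by move=> w; rewrite ger0_norm ?le_min ?f0 ?ler0n// ge_min lexx orbT.
Unshelve. all: by end_near. Qed.

End bounded_mean.

(** * Weak limits from the means of ramps *)

Lemma cdf_probability (R : realType) (F : R -> R) :
  nondecreasing F -> right_continuous F ->
  F @ -oo --> (0 : R) -> F @ +oo --> (1 : R) ->
  exists P : probability (measurableTypeR R) R,
    forall x, P [set y | y <= x] = (F x)%:E.
Proof.
move=> Fnd Frc FNy Fy.
pose G : cumulativeBounded (0 : R) (1 : R) :=
  HB.pack F (isCumulative.Build R _ R F Fnd Frc)
    (isCumulativeBounded.Build R 0 1 F FNy Fy).
exists (lebesgue_stieltjes_measure G) => x.
rewrite -(cdf_lebesgue_stieltjes_id G x) /cdf /distribution /pushforward /=.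
by congr (lebesgue_stieltjes_measure G _); apply/seteqP; split => y /=; rewrite
  in_itv.
Qed.

(** Cutting the slope of a ramp into m + 1 pieces, L and L' differ on each piece by
    at most an increment of F, and these increments add up to at most 1: hence
    L and L' differ by at most 1 / (m + 1), at every point x, whether or not F is
    continuous there. *)
Lemma subdivision_unique (R : realType) (F : R -> R) (L L' : R -> R -> R) :
  (forall x, 0 <= F x <= 1) ->
  (forall x e, 0 < e -> F x <= L x e <= F (x + e)) ->
  (forall x e, 0 < e -> F x <= L' x e <= F (x + e)) ->
  (forall x e m, 0 < e ->
    \sum_(j < m.+1) L (x + j%:R * (e / m.+1%:R)) (e / m.+1%:R) = m.+1%:R * L x e) ->
  (forall x e m, 0 < e ->
    \sum_(j < m.+1) L' (x + j%:R * (e / m.+1%:R)) (e / m.+1%:R) = m.+1%:R * L'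
      x e) ->
  forall x e, 0 < e -> L x e <= L' x e.
Proof.
move=> F01 LF LF' Ls Ls' x e e0; rewrite leNgt; apply/negP => /ltr_add_invr[m].
set M : R := m.+1%:R => LL; have M0 : 0 < M by rewrite ltr0n.
have : M * (L x e - L' x e) <= 1; last first.
  move: LL; rewrite -ltrBrDl -[_^-1]mulr1 ltr_pdivrMl// => LL.
  by rewrite leNgt => /negP; apply.
rewrite mulrBr -Ls// -Ls'// -sumrB.
pose y (j : nat) := x + j%:R * (e / M).
have eM : 0 < e / M by rewrite divr_gt0.
apply: (@le_trans _ _ (\sum_(j < m.+1) (F (y j.+1) - F (y j)))).
  apply: ler_sum => j _; have /andP[_ h] := LF (y j) _ eM.
  have /andP[h' _] := LF' (y j) _ eM.
  have -> : y j.+1 = y j + e / M by rewrite /y -natr1; ring.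
  exact: lerB.
rewrite -(big_mkord xpredT (fun j => F (y j.+1) - F (y j))) telescope_sumr//.
by have /andP[? ?] := F01 (y m.+1); have /andP[? ?] := F01 (y 0%N); lra.
Qed.

Section tent_approximation.
Context (R : realType) (h : R -> R) (M : R).
Hypothesis hM : forall y, `|h y| <= M.

(** Piecewise linear interpolation of h at the nodes 0, e, ..., me. *)
Definition tents (e : R) (m : nat) (y : R) : R :=
  \sum_(i < m.+1) h (i%:R * e) * (ramp (i%:R * e) e y - ramp (i%:R * e - e) e y).

Lemma tent_ge0 (x e y : R) : 0 < e -> 0 <= ramp x e y - ramp (x - e) e y.
Proof.
move=> e0; rewrite subr_ge0 -(ramp_shift (x - e) e y e) subrK.
by rewrite ramp_anti// lerDl ltW.
Qed.

Lemma tents_bound (e : R) (m : nat) (y : R) : 0 < e -> 0 <= y ->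
  `|tents e m y| <= M.
Proof.
move=> e0 y0; have M0 : 0 <= M by apply: le_trans (hM 0).
rewrite (le_trans (ler_norm_sum _ _ _))//.
rewrite (@le_trans _ _ (\sum_(i < m.+1)
    M * (ramp (i%:R * e) e y - ramp (i%:R * e - e) e y)))//.
  apply: ler_sum => i _; rewrite normrM [X in _ * X]ger0_norm ?tent_ge0//.
  by rewrite ler_wpM2r ?tent_ge0.
by rewrite -mulr_sumr telescope_ramp// ler_piMr ?ramp_le1.
Qed.

(** A tent centered at a node vanishes at distance e from it, so that tents
    average values of h taken at distance less than e from y. *)
Lemma tents_approx (e : R) (m : nat) (y eps : R) : 0 < e -> 0 <= eps ->
  (forall i : nat, (i <= m)%N -> `|y - i%:R * e| < e -> `|h y - h (i%:R * e)|
    <= eps) ->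
  0 <= y <= m%:R * e -> `|h y - tents e m y| <= eps.
Proof.
move=> e0 eps0 hh /andP[y0 ym].
have T1 := telescope_ramp m e0 y0; rewrite ramp1// in T1.
rewrite -[h y]mulr1 -T1 mulr_sumr /tents -sumrB.
under eq_bigr do rewrite -mulrBl.
rewrite (le_trans (ler_norm_sum _ _ _))//.
rewrite -[leRHS]mulr1 -[X in _ <= _ * X]T1 mulr_sumr; apply: ler_sum => i _.
rewrite normrM [X in _ * X]ger0_norm ?tent_ge0//.
have [iy|] := ltP `|y - i%:R * e| e.
  by rewrite ler_wpM2r ?tent_ge0// hh// -ltnS.
rewrite ler_normr => /orP[iy|iy].
  by rewrite ![ramp _ _ _]ramp0 ?subrr ?mulr0//; lra.
by rewrite ![ramp _ _ _]ramp1 ?subrr ?mulr0//; lra.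
Qed.

End tent_approximation.

Lemma continuous_segment_modulus (R : realType) (h : R -> R) (a b eps : R) :
  continuous h -> 0 < eps -> exists2 r : R, 0 < r &
    forall y z, a <= y <= b -> `|y - z| < r -> `|h y - h z| <= eps.
Proof.
move=> ch eps0.
have H : \forall r \near (0 : R)^'+, `[a, b] `<=`
    (fun y => forall z, `|y - z| < r -> `|h y - h z| <= eps).
  apply: ((compact_near_coveringP _).1 (@segment_compact R a b)) => x _.
  have e2 : 0 < eps / 2 by rewrite divr_gt0.
  have /cvgrPdist_lt /(_ _ e2) /nbhs_ballP[r /= r0 hr] := ch x.
  have r2 : 0 < r / 2 by rewrite divr_gt0.
  exists (ball x (r / 2), [set s | s < r / 2]).
    split => /=; first exact: nbhsx_ballx.
    exact: nbhs_right_lt.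
  move=> [y s] /= [xy sr] z yz.
  have hy : `|h x - h y| < eps / 2.
    by apply: hr; apply: le_ball xy; rewrite ler_pdivrMr// mulr_natr mulr2n
      lerDl ltW.
  have hz : `|h x - h z| < eps / 2.
    apply: hr; rewrite /ball /= in xy *.
    rewrite (_ : x - z = (x - y) + (y - z)); last by ring.
    rewrite (le_lt_trans (ler_normD _ _))// (splitr r) ltrD//.
    exact: lt_trans yz sr.
  rewrite (_ : h y - h z = - (h x - h y) + (h x - h z)); last by ring.
  by rewrite (le_trans (ler_normD _ _))// normrN (splitr eps) lerD// ltW.
near (0 : R)^'+ => r; exists r; first by near: r; exact: nbhs_right_gt.
have h' : `[a, b] `<=` (fun y => forall z, `|y - z| < r -> `|h y - h z| <= eps).
  by near: r.
by move=> y z yab; apply: h'; rewrite /= in_itv.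
Unshelve. all: by end_near. Qed.

Section mean_tents.
Context d (T : measurableType d) (R : realType) (P : probability T R).
Context (Y : T -> R) (h : R -> R) (M : R).
Hypothesis mY : measurable_fun [set: T] Y.
Hypothesis Y0 : forall w, 0 <= Y w.
Hypothesis EY : ('E_P[Y] <= 1)%E.
Hypothesis mh : measurable_fun [set: R] h.
Hypothesis hM : forall y, `|h y| <= M.

Let iY : P.-integrable [set: T] (EFin \o Y).
Proof.
exact: ge0_expectation_integrable.
Qed.

Lemma mean_tents (e : R) (m : nat) :
  \int[P]_w tents h e m (Y w) = \sum_(i < m.+1) h (i%:R * e) *
    (\int[P]_w ramp (i%:R * e) e (Y w) - \int[P]_w ramp (i%:R * e - e) e (Y w)).
Proof.
have ir x : P.-integrable [set: T] (EFin \o (fun w => ramp x e (Y w))).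
  exact: integrable_ramp.
have it x : P.-integrable [set: T]
    (EFin \o (fun w => ramp x e (Y w) - ramp (x - e) e (Y w))).
  apply: eq_integrable (integrableB measurableT (ir x) (ir (x - e))) => //.
rewrite Rintegral_sum; last first.
  move=> i; apply: eq_integrable (integrableZl measurableT (h (i%:R * e)) (it
    (i%:R * e))) => //.
by apply: eq_bigr => i _; rewrite RintegralZl// RintegralB.
Qed.

(** Beyond K, where the interpolation fails, the error is at most
    2 M <= 2 M Y / K, which has mean at most 2 M / K. *)
Lemma mean_tents_approx (eps K e : R) (m : nat) : 0 < e -> 0 <= eps -> 0 < K ->
  m%:R * e = K ->
  (forall y z, 0 <= y <= K -> `|y - z| < e -> `|h y - h z| <= eps) ->
  `|\int[P]_w h (Y w) - \int[P]_w tents h e m (Y w)| <= eps + 2 * M / K.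
Proof.
move=> e0 eps0 K0 meK he; have M0 : 0 <= M by apply: le_trans (hM 0).
have ihY : P.-integrable [set: T] (EFin \o (h \o Y)).
  apply: (@bounded_integrable _ _ _ _ _ M) => [|w]; last exact: hM.
  exact: measurableT_comp mh mY.
have mt : measurable_fun [set: T] (fun w => tents h e m (Y w)).
  apply: (@measurableT_comp _ _ _ _ _ _ (tents h e m)) => //.
  apply: measurable_sum => i; apply: measurable_funM => //.
  by apply: measurable_funB; exact: measurable_ramp.
have itY : P.-integrable [set: T] (EFin \o (fun w => tents h e m (Y w))).
  by apply: (@bounded_integrable _ _ _ _ _ M) => // w; exact: tents_bound.
have iD : P.-integrable [set: T] (EFin \o (fun w => h (Y w) - tents h e m (Y w))).
  exact: eq_integrable (integrableB measurableT ihY itY).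
have i1 : P.-integrable [set: T] (EFin \o (fun w => eps + 2 * M / K * Y w)).
  have ie := integrable_cst P eps.
  exact: eq_integrable (integrableD measurableT ie
    (integrableZl measurableT (2 * M / K) iY)).
rewrite -RintegralB// (le_trans (le_normr_Rintegral _ _))//.
apply: (@le_trans _ _ (\int[P]_w (eps + 2 * M / K * Y w))).
  apply: le_Rintegral => //; first exact: integrable_norm.
  move=> w _; have [YK|KY] := leP (Y w) K.
    apply: ler_wpDr; first by rewrite mulr_ge0// divr_ge0 ?mulr_ge0// ltW.
    apply: tents_approx => //; last by rewrite Y0 meK.
    by move=> i _; apply: he; rewrite Y0 YK.
  apply: ler_wpDl => //; apply: (@le_trans _ _ (2 * M)).
    rewrite (le_trans (ler_normB _ _))// mulr_natl mulr2n lerD//.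
    exact: tents_bound.
  by rewrite -mulrA ler_peMr ?mulr_ge0// ler_pdivlMl// mulr1 ltW.
have ie := integrable_cst P eps.
rewrite RintegralD//; last exact: (integrableZl measurableT (2 * M / K) iY).
rewrite RintegralZl//; apply: lerD.
  by rewrite Rintegral_prob_cst.
rewrite ler_piMr ?divr_ge0 ?mulr_ge0 ?(ltW K0)//.
by move: EY; rewrite expectation_Rintegral// lee_fin.
Qed.

End mean_tents.

Lemma cvg_sum (R : realType) (I : Type) (s : seq I) (u : I -> nat -> R)
    (l : I -> R) : (forall i, u i n @[n --> \oo] --> l i) ->
  \sum_(i <- s) u i n @[n --> \oo] --> \sum_(i <- s) l i.
Proof.
move=> ul; elim: s => [|i s IH].
  by rewrite big_nil; under eq_fun do rewrite big_nil; exact: cvg_cst.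
by rewrite big_cons; under eq_fun do rewrite big_cons; exact: cvgD.
Qed.

(** The mean of an interpolation by tents is a finite linear combination of means
    of ramps, and it approximates E h(Y) uniformly over the Y of mean at most 1. *)
Lemma cvg_ramps_in_distribution (R : realType) (d : nat -> measure_display)
    (T : forall n, measurableType (d n)) (P : forall n, probability (T n) R)
    (Y : forall n, T n -> R)
    (mY : forall n, measurable_fun [set: T n] (Y n))
    (Y0 : forall n w, 0 <= Y n w) (EY : forall n, ('E_(P n)[Y n] <= 1)%E)
    (d' : measure_display) (T' : measurableType d')
    (P' : probability T' R) (Z : T' -> R) :
  measurable_fun [set: T'] Z -> (forall w, 0 <= Z w) -> ('E_P'[Z] <= 1)%E ->
  (forall x e : R, 0 < e -> \int[P n]_w ramp x e (Y n w) @[n --> \oo] -->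
     \int[P']_w ramp x e (Z w)) ->
  cvg_in_distribution P Y P' Z.
Proof.
move=> mZ Z0 EZ cvgr h ch /pinfty_ex_gt0[M M0 hM'].
have hM y : `|h y| <= M by exact: hM'.
have mh := continuous_measurable_fun ch.
have ih d1 (T1 : measurableType d1) (P1 : probability T1 R) (f : T1 -> R) :
    measurable_fun [set: T1] f -> P1.-integrable [set: T1] (EFin \o (h \o f)).
  move=> mf; apply: (@bounded_integrable _ _ _ _ _ M) => [|w]; last exact: hM.
  exact: measurableT_comp mh mf.
rewrite (_ : (fun n => 'E_(P n)[h \o Y n])%E =
    (fun n => (\int[P n]_w (h (Y n w)))%:E)); last first.
  by apply/funext => n; rewrite expectation_Rintegral//; exact: ih.
rewrite expectation_Rintegral; last exact: ih.
apply: cvg_EFin; first exact: nearW.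
apply/cvgrPdist_le => eps eps0 /=.
have e4 : 0 < eps / 5 by rewrite divr_gt0.
pose K := 2 * M / (eps / 5); have K0 : 0 < K by rewrite divr_gt0 ?mulr_gt0.
have MK : 2 * M / K = eps / 5.
  by rewrite /K invf_div mulrCA mulfV ?mulr1// mulf_neq0// gt_eqF.
have [r r0 hr] := continuous_segment_modulus 0 K ch e4.
pose m := (Num.trunc (K / r)).+1.
have m0 : (0 : R) < m%:R by rewrite ltr0n.
have Krm : K / r < m%:R by exact: truncnS_gt.
pose e := K / m%:R; have e0 : 0 < e by rewrite divr_gt0.
have er : e < r by rewrite /e ltr_pdivrMr// mulrC -ltr_pdivrMr.
have meK : m%:R * e = K by rewrite /e mulrC divfK// gt_eqF.
have he y z : 0 <= y <= K -> `|y - z| < e -> `|h y - h z| <= eps / 5.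
  by move=> yK yz; apply: hr => //; exact: lt_trans yz er.
have App d1 (T1 : measurableType d1) (P1 : probability T1 R) (f : T1 -> R)
    (mf : measurable_fun [set: T1] f) (f0 : forall w, 0 <= f w)
    (Ef : ('E_P1[f] <= 1)%E) :
    `|\int[P1]_w h (f w) - \int[P1]_w tents h e m (f w)| <= eps / 5 + eps / 5.
  by rewrite -[X in _ <= _ + X]MK; apply: mean_tents_approx => //; exact: ltW.
have : \int[P n]_w tents h e m (Y n w) @[n --> \oo] -->
    \int[P']_w tents h e m (Z w).
  rewrite (_ : (fun n => _) = fun n => \sum_(i < m.+1) h (i%:R * e) *
    (\int[P n]_w ramp (i%:R * e) e (Y n w) - \int[P n]_w ramp (i%:R * e - e) e
      (Y n w))).
    rewrite mean_tents//; apply: cvg_sum => i; apply: cvgMl_tmp.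
    by apply: cvgB; exact: cvgr.
  by apply/funext => n; rewrite mean_tents.
move=> /cvgrPdist_le /(_ _ e4); apply: filterS => n tn.
have A1 := App _ _ _ _ mZ Z0 EZ; have A2 := App _ _ _ _ (mY n) (@Y0 n) (EY n).
move: A1 A2 tn; rewrite !ler_norml => /andP[? ?] /andP[? ?] /andP[? ?].
by apply/andP; split; lra.
Qed.

(** Let L x e be the limit of the means of the ramp of slope [x, x + e].  Then
    F x = inf_e L x e satisfies F x <= L x e <= F (x + e), so that F is right
    continuous (a ramp moves by at most t / e when x moves by t), and the bound
    1 on the means of Y prevents mass from escaping to infinity.  The random
    variable with distribution function F has the means L on the ramps by
    uniqueness under subdivision. *)
Theorem ramp_limit_representation (R : realType) (d : nat -> measure_display)
    (T : forall n, measurableType (d n)) (P : forall n, probability (T n) R)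
    (Y : forall n, T n -> R)
    (mY : forall n, measurable_fun [set: T n] (Y n))
    (Y0 : forall n w, 0 <= Y n w) (EY : forall n, ('E_(P n)[Y n] <= 1)%E) :
  (forall x e : R, 0 < e -> cvgn (fun n => \int[P n]_w ramp x e (Y n w))) ->
  exists (d' : measure_display) (T' : measurableType d')
    (P' : probability T' R) (Z : {RV P' >-> R}),
    [/\ forall w, 0 <= Z w, ('E_P'[Z] <= 1)%E &
      forall x e : R, 0 < e ->
        \int[P n]_w ramp x e (Y n w) @[n --> \oo] --> \int[P']_w ramp x e (Z w)].
Proof.
move=> cvgr.
pose a x e n := \int[P n]_w ramp x e (Y n w).
pose L x e := lim (a x e n @[n --> \oo]).
have ir n (x e : R) : (P n).-integrable [set: T n] (EFin \o (fun w => ramp x e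
  (Y n w))).
  exact: integrable_ramp.
have iY n : (P n).-integrable [set: T n] (EFin \o Y n).
  exact: ge0_expectation_integrable.
have a01 x e n : 0 < e -> 0 <= a x e n <= 1.
  move=> e0; apply: Rintegral_le1.
    exact: measurableT_comp (measurable_ramp x e) (mY n).
  by move=> w; rewrite ramp_ge0 ramp_le1.
have L01 x e : 0 < e -> 0 <= L x e <= 1.
  move=> e0; apply/andP; split.
    by apply: limr_ge; [exact: cvgr|apply: nearW => n; case/andP: (a01 x e n e0)].
  by apply: limr_le; [exact: cvgr|apply: nearW => n; case/andP: (a01 x e n e0)].
have L_le x e x' e' k : 0 < e -> 0 < e' ->
    (forall y, ramp x e y <= ramp x' e' y + k) -> L x e <= L x' e' + k.
  move=> e0 e0' h.
  have c1 : a x e n @[n --> \oo] --> L x e by exact: cvgr.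
  have c2 : a x' e' n + k @[n --> \oo] --> L x' e' + k.
    by apply: cvgD; [exact: cvgr|exact: cvg_cst].
  apply: (ler_cvg_to c1 c2); apply: nearW => n /=.
  rewrite -(Rintegral_prob_cst (P n) k) -RintegralD//; last exact: integrable_cst.
  apply: le_Rintegral => //.
  exact: eq_integrable (integrableD measurableT (ir n x' e') (integrable_cst _ k)).
have L_le0 x e x' e' : 0 < e -> 0 < e' ->
    (forall y, ramp x e y <= ramp x' e' y) -> L x e <= L x' e'.
  by move=> e0 e0' h; rewrite -[leRHS]addr0; apply: L_le => // y; rewrite addr0.
pose E x := [set L x e | e in [set e : R | 0 < e]].
have E0 x : E x !=set0 by exists (L x 1), 1 => //=.
have lbE x : lbound (E x) 0 by move=> _ [e /= e0 <-]; case/andP: (L01 x e e0).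
have hlbE x : has_lbound (E x) by exists 0.
pose F x := inf (E x).
(* F x and L x e interlace *)
have FL x e : 0 < e -> F x <= L x e by move=> e0; apply: ge_inf => //; exists e.
have LF x e : 0 < e -> L x e <= F (x + e).
  move=> e0; apply: lb_le_inf => // _ [e' /= e0' <-]; apply: L_le0 => // y.
  have [yx|/ltW xy] := leP y (x + e); last by rewrite ramp0// ramp_ge0.
  by rewrite [leRHS]ramp1// ramp_le1.
have F01 x : 0 <= F x <= 1.
  rewrite lb_le_inf//= (le_trans (FL x 1 ltr01))//.
  by case/andP: (L01 x 1 ltr01).
have Fnd : nondecreasing F.
  move=> x y; rewrite le_eqVlt => /orP[/eqP->//|xy].
  have yx0 : 0 < y - x by rewrite subr_gt0.
  by rewrite (le_trans (FL x _ yx0))// (le_trans (LF x _ yx0))// subrKC.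
have Frc : right_continuous F.
  move=> x; apply/cvgrPdist_le => eps eps0.
  have e2 : 0 < eps / 2 by rewrite divr_gt0.
  have [_ [e /= e0 <-] hL] := inf_adherent e2 (conj (E0 x) (hlbE x)).
  have ee : 0 < e * (eps / 2) by rewrite mulr_gt0.
  near=> t.
  have xt : x < t by near: t; exact: nbhs_right_gt.
  rewrite distrC ger0_norm; last by rewrite subr_ge0 Fnd// ltW.
  rewrite lerBlDl.
  rewrite (le_trans (FL t e e0))//.
  apply: (@le_trans _ _ (L x e + eps / 2)); last first.
    by rewrite {2}(splitr eps) addrA lerD2r; exact: ltW hL.
  apply: L_le => // y.
  have tx : t - x <= e * (eps / 2).
    by rewrite lerBlDl ltW//; near: t; apply: nbhs_right_lt; rewrite ltrDl.
  rewrite -{1}(subrKC x t) -(subrK (t - x) y) ramp_shift.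
  rewrite (le_trans (@ramp_lip _ x e (y - (t - x)) y e0 _))//.
    by rewrite gerBl subr_ge0 ltW.
  rewrite subrK lerD2l opprB addrC subrK ler_pdivrMr//.
  by rewrite mulrC.
have FN x : x < 0 -> F x = 0.
  move=> x0; apply/eqP; rewrite eq_le; case/andP: (F01 x) => -> _; rewrite andbT.
  have nx0 : 0 < - x by rewrite oppr_gt0.
  rewrite (le_trans (FL _ _ nx0))//; apply: limr_le; first exact: cvgr.
  apply: nearW => n; rewrite /a (_ : Rintegral _ _ _ = 0)//.
  rewrite -[RHS](mul0r (fine (P n setT))) -Rintegral_cst//.
  by apply: eq_Rintegral => w _ /=; rewrite ramp0// subrr.
have FNy : F @ -oo --> (0 : R).
  apply: cvg_near_cst; near=> x; apply/FN; near: x.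
  exact: nbhs_ninfty_lt.
(* Markov: 1 - y / x is below every ramp of slope [x, x + e] when y >= 0 *)
have Fge x : 0 < x -> 1 - x^-1 <= F x.
  move=> x0; apply: lb_le_inf => // _ [e /= e0 <-].
  apply: limr_ge; [exact: cvgr|apply: nearW => n].
  apply: (@le_trans _ _ (\int[P n]_w (1 - x^-1 * Y n w))).
    rewrite RintegralB//; [|exact: integrable_cst|exact: (integrableZl
      measurableT x^-1 (iY n))].
    rewrite Rintegral_prob_cst RintegralZl// lerD2l lerN2.
    rewrite ler_piMr//; first by rewrite invr_ge0 ltW.
    by move: (EY n); rewrite expectation_Rintegral// lee_fin.
  apply: le_Rintegral => //.
    exact: eq_integrable (integrableB measurableT (integrable_cst _ 1)
       (integrableZl measurableT x^-1 (iY n))).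
  move=> w _; have [yx|xy] := leP (Y n w) x.
    by rewrite ramp1// gerBl mulr_ge0// invr_ge0 ltW.
  rewrite (@le_trans _ _ 0) ?ramp_ge0// subr_le0 ler_pdivlMl// mulr1; exact: ltW.
have Fy : F @ +oo --> (1 : R).
  apply/cvgrPdist_le => eps eps0; near=> x.
  have x0 : 0 < x by near: x; exact: nbhs_pinfty_gt.
  rewrite ger0_norm ?subr_ge0; last by case/andP: (F01 x).
  rewrite lerBlDr -lerBlDl (le_trans _ (Fge x x0))// lerD2l lerN2.
  rewrite -[leRHS]invrK lef_pV2 ?posrE ?invr_gt0//.
have [P' P'F] := cdf_probability Fnd Frc FNy Fy.
(* F vanishes on negative numbers: taking positive parts preserves the law and
   makes Z nonnegative everywhere *)
pose Z0 := fun w : measurableTypeR R => Num.max (0 : R) w.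
have mZ : measurable_fun [set: measurableTypeR R] Z0.
  by apply: measurable_maxr => //; exact: measurable_id.
pose Z : {RV P' >-> R} := HB.pack Z0 (isMeasurableFun.Build _ _ _ _ _ mZ).
have ZF x : P' [set w | Z w <= x] = (F x)%:E.
  have [x0|x0] := leP 0 x.
    rewrite -P'F; congr (P' _); apply/seteqP; split => w /=;
      by rewrite /Z0 ge_max x0.
  rewrite FN// (_ : [set w | _] = set0) ?measure0//.
  by rewrite -subset0 => w /=; rewrite /Z0 ge_max leNgt x0.
have LZ x e : 0 < e -> L x e = \int[P']_w ramp x e (Z w).
  pose L' (x e : R) := \int[P']_w ramp x e (Z w).
  have H1 x1 e1 : 0 < e1 -> F x1 <= L x1 e1 <= F (x1 + e1).
    by move=> e0; rewrite FL// LF.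
  have H2 x1 e1 : 0 < e1 -> F x1 <= L' x1 e1 <= F (x1 + e1).
    move=> e0; have := ramp_mean_cdf P' x1 mZ e0.
    by rewrite ![P' _]ZF.
  have H3 x1 e1 m : 0 < e1 ->
      \sum_(j < m.+1) L (x1 + j%:R * (e1 / m.+1%:R)) (e1 / m.+1%:R) = m.+1%:R *
        L x1 e1.
    move=> e0; have em0 : 0 < e1 / m.+1%:R by rewrite divr_gt0.
    have c1 : \sum_(j < m.+1) a (x1 + j%:R * (e1 / m.+1%:R)) (e1 / m.+1%:R) n
        @[n --> \oo] --> \sum_(j < m.+1) L (x1 + j%:R * (e1 / m.+1%:R)) (e1 /
          m.+1%:R).
      by apply: cvg_sum => j; exact: cvgr.
    have c2 : m.+1%:R * a x1 e1 n @[n --> \oo] --> m.+1%:R * L x1 e1.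
      by apply: cvgMl_tmp; exact: cvgr.
    rewrite -(cvg_lim (@Rhausdorff R) c1) -(cvg_lim (@Rhausdorff R) c2).
    congr (lim (_ @ \oo)); apply/funext => n.
    rewrite /a -RintegralZl// -Rintegral_sum//.
    by apply: eq_Rintegral => w _; rewrite ramp_subdivision.
  have H4 x1 e1 m : 0 < e1 ->
      \sum_(j < m.+1) L' (x1 + j%:R * (e1 / m.+1%:R)) (e1 / m.+1%:R) = m.+1%:R
        * L' x1 e1.
    move=> e0; have iZ (y e2 : R) : P'.-integrable setT (EFin \o (fun w => ramp
      y e2 (Z w))).
      exact: integrable_ramp.
    rewrite /L' -RintegralZl// -Rintegral_sum//.
    by apply: eq_Rintegral => w _; rewrite ramp_subdivision.
  move=> e0; apply/eqP; rewrite eq_le.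
  by rewrite (subdivision_unique F01 H1 H2)// (subdivision_unique F01 H2 H1).
have Zge0 w : 0 <= Z w by rewrite /= /Z0 le_max lexx.
have cZ x e : 0 < e -> a x e n @[n --> \oo] --> \int[P']_w ramp x e (Z w).
  by move=> e0; rewrite -LZ//; exact: cvgr.
exists _, _, P', Z; split => //.
apply: expectation_le1_of_min => // k.
have K0 : (0 : R) < k.+1%:R by rewrite ltr0n.
rewrite Rintegral_min//.
have cK : k.+1%:R * (1 - a 0 k.+1%:R n) @[n --> \oo] -->
    k.+1%:R * (1 - \int[P']_w ramp 0 k.+1%:R (Z w)).
  by apply: cvgMl_tmp; apply: cvgB; [exact: cvg_cst|exact: cZ].
rewrite -(cvg_lim (@Rhausdorff R) cK).
apply: limr_le; first by apply/cvg_ex; eexists; exact: cK.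
apply: nearW => n; rewrite -Rintegral_min//.
apply: (@le_trans _ _ (\int[P n]_w Y n w)).
  apply: le_Rintegral => //; last by move=> w _; rewrite ge_min lexx.
  apply: (@bounded_integrable _ _ _ _ _ k.+1%:R); first exact: measurable_minr.
  by move=> w; rewrite ger0_norm ?le_min ?Y0 ?ler0n// ge_min lexx orbT.
by move: (EY n); rewrite expectation_Rintegral// lee_fin.
Unshelve. all: by end_near. Qed.

(** * Iterated pagerank on a finite graph *)

Section pagerank.
Context (R : realType) (n : nat) (e : 'I_n -> 'I_n -> nat).
Implicit Types (C B x : 'I_n -> R).

Definition pr_step C B x (i : 'I_n) : R :=
  \sum_(j < n) C j * (e j i)%:R / (\sum_(k < n) e j k)%:R * x j + B i.

Definition pr_iter C B (N : nat) : 'I_n -> R := iter N (pr_step C B) (fun=> 0).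

Context (C B PR : 'I_n -> R) (c : R).
Hypotheses (c0 : 0 <= c) (c1 : c < 1).
Hypothesis Cc : forall i, 0 <= C i <= c.
Hypothesis B0 : forall i, 0 <= B i.
Hypothesis prPR : is_pagerank e C B PR.

Let w (j i : 'I_n) : R := C j * (e j i)%:R / (\sum_(k < n) e j k)%:R.

Let w_ge0 j i : 0 <= w j i.
Proof. by case/andP: (Cc j) => C0 _; rewrite divr_ge0 ?mulr_ge0. Qed.

Let sum_w j : \sum_(i < n) w j i <= c.
Proof.
case/andP: (Cc j) => C0 Cjc.
rewrite -mulr_suml -mulr_sumr -natr_sum -mulrA.
have [->|s0] := eqVneq (\sum_(k < n) e j k)%N 0%N.
  by rewrite mul0r mulr0 (le_trans C0).
by rewrite mulfV ?mulr1// pnatr_eq0.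
Qed.

(** The out-weights of a vertex sum to at most c: pagerank is a contraction in
    the l1 norm, whatever the in-degrees. *)
Let contraction x : \sum_(i < n) `|\sum_(j < n) w j i * x j| <=
  c * \sum_(j < n) `|x j|.
Proof.
apply: (@le_trans _ _ (\sum_(i < n) \sum_(j < n) w j i * `|x j|)).
  apply: ler_sum => i _; apply: le_trans (ler_norm_sum _ _ _) _.
  by apply: ler_sum => j _; rewrite normrM ger0_norm.
rewrite exchange_big mulr_sumr; apply: ler_sum => j _.
by rewrite -mulr_suml ler_wpM2r.
Qed.

Let pr_iterS N i : pr_iter C B N.+1 i = \sum_(j < n) w j i * pr_iter C B N j + B i.
Proof. by []. Qed.

Lemma pr_iter_contract N : \sum_(i < n) `|PR i - pr_iter C B N i| <=
  c ^+ N * \sum_(i < n) `|PR i|.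
Proof.
elim: N => [|N IH]; first by under eq_bigr do rewrite subr0; rewrite mul1r.
under eq_bigr => i _.
  rewrite pr_iterS (prPR i) opprD addrACA subrr addr0 -sumrB.
  under eq_bigr do rewrite -mulrBr.
  over.
apply: le_trans (contraction _) _; rewrite exprS -mulrA ler_wpM2l//.
Qed.

Lemma cvg_pr_iter i : pr_iter C B N i @[N --> \oo] --> PR i.
Proof.
suff : `|PR i - pr_iter C B N i| @[N --> \oo] --> 0.
  by move=> h; apply/subr_cvg0/norm_cvg0P; under eq_fun do rewrite /= distrC.
have cN : c ^+ N * \sum_(j < n) `|PR j| @[N --> \oo] --> (0 : R).
  rewrite -[X in _ --> X](mul0r (\sum_(j < n) `|PR j|)); apply: cvgMr_tmp.
  by apply: cvg_expr; rewrite ger0_norm.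
apply: (squeeze_cvgr _ (cvg_cst (0 : R)) cN); apply: nearW => N.
rewrite normr_ge0/= (le_trans _ (pr_iter_contract N))//.
by rewrite (bigD1 i)//= lerDl sumr_ge0.
Qed.

Lemma pr_iter_nondecreasing i : nondecreasing_seq (fun N => pr_iter C B N i).
Proof.
apply/nondecreasing_seqP => N; elim: N i => [|N IH] i.
  by rewrite pr_iterS big1 ?add0r// => j _; rewrite mulr0.
rewrite [in leRHS]pr_iterS pr_iterS lerD2r; apply: ler_sum => j _.
by rewrite ler_wpM2l.
Qed.

Lemma pr_iter_ge0 N i : 0 <= pr_iter C B N i.
Proof. exact: (pr_iter_nondecreasing i (leq0n N)). Qed.

Lemma pr_iter_le N i : pr_iter C B N i <= PR i.
Proof.
rewrite -(cvg_lim (@Rhausdorff R) (@cvg_pr_iter i)).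
apply: (nondecreasing_cvgn_le (@pr_iter_nondecreasing i)).
by apply/cvg_ex; exists (PR i); exact: cvg_pr_iter.
Qed.

Lemma pagerank_ge0 i : 0 <= PR i.
Proof. exact: le_trans (pr_iter_ge0 0 i) (pr_iter_le 0 i). Qed.

(** Summing the equation over the vertices: total <= c * total + total of B. *)
Lemma sum_pagerank_le : \sum_(i < n) PR i <= (1 - c)^-1 * \sum_(i < n) B i.
Proof.
rewrite ler_pdivlMl ?subr_gt0// mulrBl mul1r lerBlDl.
rewrite [leLHS](eq_bigr _ (fun i _ => prPR i)) big_split/= lerD2r.
apply: le_trans (le_trans (contraction PR) _).
  by apply: ler_sum => i _; exact: ler_norm.
by rewrite ler_wpM2l//; apply: ler_sum => i _; rewrite ger0_norm ?pagerank_ge0.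
Qed.

Lemma sum_pr_iter_error N : \sum_(i < n) (PR i - pr_iter C B N i) <=
  c ^+ N * ((1 - c)^-1 * \sum_(i < n) B i).
Proof.
apply: le_trans (le_trans (pr_iter_contract N) _).
  by apply: ler_sum => i _; exact: ler_norm.
rewrite ler_wpM2l ?exprn_ge0// (le_trans _ sum_pagerank_le)//.
by apply: ler_sum => i _; rewrite ger0_norm ?pagerank_ge0.
Qed.

End pagerank.

(** * Locality of the iterates *)

Section rooted_iterates.
Context (R : realType) {X : Type}.
Implicit Types (G H : mgraph X) (c b : nat -> R).

(** Edge weights are divided by the mark of the source rather than by its
    out-degree: neighborhoods truncate out-degrees but keep marks. *)
Fixpoint mg_iter G c b (N v : nat) : R :=
  if N is M.+1 then
    \sum_(j \in [set: nat])
      c j * (mult G j v)%:R / (mark G j)%:R * mg_iter G c b M j + b v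
  else 0.

(** One iteration moves one step against the edges, so that the vertices used by
    N iterations from distance k lie within distance k + N of the root. *)
Lemma mg_iter_nbhd G c b (K N k v : nat) : (k + N <= K)%N ->
  nbhd_vertex k G v -> mg_iter (nbhd K G) c b N v = mg_iter G c b N v.
Proof.
elim: N k v => [//|N IH] k v; rewrite addnS => kNK Gv /=.
have kK : (k < K)%N by rewrite (leq_trans _ kNK)// ltnS leq_addr.
congr (_ + _); apply: eq_fsbigr => j _.
have [jv|jv] := eqVneq (mult G j v) 0%N.
  have -> : nbhd_mult K G j v = 0%N.
    by apply/eqP; rewrite -leqn0 -jv; exact: nbhd_mult_le.
  by rewrite jv !mulr0 !mul0r.
have [p [pp lp sp]] := Gv.
have Gj : nbhd_vertex k.+1 G j by exists (v :: p); rewrite /= jv.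
rewrite (IH k.+1)// /nbhd_mult (leq_ltn_trans (leq0n k) kK) !mem_set//.
  by exists p; split => //; rewrite (leq_trans sp)// ltnW.
by exists (v :: p); rewrite /= jv; split => //; rewrite (leq_ltn_trans sp).
Qed.

Lemma mg_iter_bij G H (f : nat -> nat) c b c' b' (N v : nat) :
  set_bij (vertex G) (vertex H) f ->
  {in vertex G &, forall i j, mult H (f i) (f j) = mult G i j} ->
  {in vertex G, forall i, mark H (f i) = mark G i} ->
  {in vertex G, forall i, c' (f i) = c i} ->
  {in vertex G, forall i, b' (f i) = b i} ->
  v \in vertex G -> mg_iter H c' b' N (f v) = mg_iter G c b N v.
Proof.
move=> fb fe fm fc fb'; elim: N v => [//|N IH] v vG /=; rewrite fb'//.
congr (_ + _).
rewrite -(@fsbig_widen _ _ _ _ (vertex H) [set: nat])//; last first.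
  move=> j [_ /= jH]; rewrite (_ : mult H j (f v) = 0%N) ?mulr0 ?mul0r//.
  by apply/eqP/negPn/negP => /mult_vertex[].
rewrite -(@fsbig_widen _ _ _ _ (vertex G) [set: nat])//; last first.
  move=> j [_ /= jG]; rewrite (_ : mult G j v = 0%N) ?mulr0 ?mul0r//.
  by apply/eqP/negPn/negP => /mult_vertex[].
rewrite (@reindex_fsbig _ _ _ _ _ f (vertex G) (vertex H) _ fb); apply:
  eq_fsbigr => j jG.
by rewrite fc// fm// fe// IH.
Qed.

(** N iterations at the root explore the in-paths of length at most N. *)
Lemma mg_iter_local G H (f : nat -> nat) c b c' b' (K N : nat) : (N <= K)%N ->
  set_bij (nbhd_vertex K G) (nbhd_vertex K H) f ->
  {in nbhd_vertex K G &, forall i j, nbhd_mult K H (f i) (f j) = nbhd_mult K G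
    i j} ->
  f (Defs.root G) = Defs.root H ->
  {in nbhd_vertex K G, forall i, mark H (f i) = mark G i} ->
  {in nbhd_vertex K G, forall i, c' (f i) = c i} ->
  {in nbhd_vertex K G, forall i, b' (f i) = b i} ->
  mg_iter H c' b' N (Defs.root H) = mg_iter G c b N (Defs.root G).
Proof.
move=> NK fb fe fr fm fc fb'.
rewrite -(@mg_iter_nbhd G _ _ K N 0); [|by []|exact: nbhd_root].
rewrite -(@mg_iter_nbhd H _ _ K N 0); [|by []|exact: nbhd_root].
rewrite -fr; apply: mg_iter_bij => //=.
by apply/mem_set; exact: nbhd_root.
Qed.

End rooted_iterates.

Section finite_iterates.
Context (R : realType) (X : pointedType) (n : nat) (e : 'I_n -> 'I_n -> nat)
  (x : 'I_n -> X).

(** Vertices are natural numbers in rooted graphs; the value off the graph is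
    irrelevant to the iterates, which follow edges. *)
Definition ord_ext (F : 'I_n -> R) (k : nat) : R := oapp F 0 (insub k).

Lemma ord_extE F (i : 'I_n) : ord_ext F i = F i.
Proof. by rewrite /ord_ext valK. Qed.

Lemma mg_iter_ord (r : 'I_n) (C B : 'I_n -> R) (c b : nat -> R) (N : nat)
    (i : 'I_n) :
  (forall j : 'I_n, c j = C j) -> (forall j : 'I_n, b j = B j) ->
  mg_iter (ord_mgraph e x r) c b N i = pr_iter e C B N i.
Proof.
move=> cC bB; elim: N i => [//|N IH] i /=.
rewrite bB /pr_step -/(pr_iter e C B N); congr (_ + _).
transitivity (\sum_(j \in `I_n) c j * (ord_mult e j i)%:R /
    (outdeg (ord_mult e) j)%:R * mg_iter (ord_mgraph e x r) c b N j).
  apply/esym/fsbig_widen => // j [_ /= /negP]; rewrite -leqNgt => nj.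
  rewrite (_ : ord_mult e j i = 0%N) ?mulr0 ?mul0r//.
  by rewrite /ord_mult; case: insubP => // j' + _; rewrite ltnNge nj.
rewrite -fsbig_ord; apply: eq_bigr => j _.
by rewrite cC ord_multE outdeg_ord IH.
Qed.

End finite_iterates.

Section local_functions.
Context (R : realType) (X : pointedType).

Lemma lwrepr_nbhd (G : mgraph X) (K : nat) : (0 < K)%N ->
  miso (nbhd K (lwrepr (lwclass R G))) (nbhd K G).
Proof. by move=> K0; have /eqP/dloc_eq0P/(_ _ K0) := lwreprK R G. Qed.

(** Two graphs at distance less than 1/(1+K) have the same K-neighborhoods, so
    that a function of the K-neighborhood is locally constant. *)
Lemma local_continuous (f : lwspace R X -> R) (K : nat) : (0 < K)%N ->
  (forall x y, miso (nbhd K (lwrepr x)) (nbhd K (lwrepr y)) -> f x = f y) ->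
  continuous f.
Proof.
move=> K0 fK x; suff H : \forall y \near x, f y = f x.
  by move=> A /nbhs_singleton fA; apply: filterS H => y /= ->.
apply/(@nbhs_ballP R).
exists (1 + K%:R)^-1; first by rewrite /= invr_gt0 ltr_wpDr.
move=> y; rewrite ballEmdist /= => xy; apply/esym/fK.
move: xy; rewrite [mdist x y]/(dloc R (lwrepr x) (lwrepr y)) /dloc.
have same G H : ~~ differ_at G H K -> miso (nbhd K G) (nbhd K H) :> Prop.
  by rewrite /differ_at K0 /= => /asboolPn/contrapT.
case: pselect => [ex|nex _]; last by apply: same; apply/negP => h; apply: nex;
  exists K.
case: ex_minnP => m _ mmin; rewrite ltf_pV2; first rewrite ltrD2l ltr_nat => Km.
- by apply: same; apply/negP => /mmin; rewrite leqNgt Km.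
- by rewrite posrE ltr_wpDr.
- by rewrite posrE ltr_wpDr.
Qed.

End local_functions.

(** * Independence *)

Section sub_sigma_algebra.
Context d (T : measurableType d) (R : realType) (P : probability T R).

Lemma sigma_rv_preimage (d' : measure_display) (T' : measurableType d')
    (I : Type) (X : I -> T -> T') (i : I) (A : set T') :
  measurable A -> sigma_rv X (X i @^-1` A).
Proof.
by move=> mA; apply: sub_sigma_algebra; exists i => //; exists A => //; rewrite
  setTI.
Qed.

Lemma sigma_rv_measurable (d' : measure_display) (T' : measurableType d')
    (I : Type) (X : I -> T -> T') :
  (forall i, measurable_fun [set: T] (X i)) -> sigma_rv X `<=` measurable.
Proof.
move=> mX; apply: smallest_sub; first exact: sigma_algebra_measurable.
by move=> _ [i _ [A mA <-]]; exact: mX.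
Qed.

Lemma g_sigma_measurable (S : set_system T) : S `<=` measurable ->
  <<s S >> `<=` measurable.
Proof. by apply: smallest_sub; exact: sigma_algebra_measurable. Qed.

Lemma g_sigma_measurable_fun (d' : measure_display) (T' : measurableType d')
    (S : set_system T) (g : T -> T') : S `<=` measurable ->
  measurable_fun [set: g_sigma_algebraType S] g -> measurable_fun [set: T] g.
Proof. by move=> Sm mg _ A mA; apply: (g_sigma_measurable Sm); exact: mg. Qed.

(** The measures D |-> P (A :&: D) and D |-> P A * P D agree on the sigma-algebra
    generated by S, hence so do the integrals of S-measurable functions. *)
Lemma indep_integral (S : set_system T) (A : set T) (g : T -> R) :
  S `<=` measurable -> measurable A ->
  (forall D, <<s S >> D -> P (A `&` D) = (P A * P D)%E) ->
  measurable_fun [set: g_sigma_algebraType S] g -> (forall w, 0 <= g w) ->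
  (\int[P]_(w in A) (g w)%:E = P A * \int[P]_w (g w)%:E)%E.
Proof.
move=> Sm mA indA mg g0.
pose h : T -> g_sigma_algebraType S := id.
have mh : measurable_fun [set: T] h.
  by move=> _ D mD; rewrite setTI; exact: (g_sigma_measurable Sm).
have mgT := g_sigma_measurable_fun Sm mg.
have mgE : measurable_fun [set: T] (EFin \o g) by exact/measurable_EFinP.
have mgSE : measurable_fun [set: g_sigma_algebraType S] (EFin \o g).
  exact/measurable_EFinP.
transitivity (\int[mrestr P mA]_(w in A) (g w)%:E)%E.
  by apply: eq_measure_integral => D mD DA; rewrite /= /mrestr setIidl.
transitivity (\int[mrestr P mA]_w (g w)%:E)%E.
  rewrite [RHS](@ge0_negligible_integral _ _ _ _ _ (~` A))//.
  - by rewrite setTD setCK.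
  - exact: measurableC.
  - by move=> w _; rewrite lee_fin.
  - by rewrite /= /mrestr setICl measure0.
have fPA : P A \is a fin_num by exact: fin_num_measure.
pose k : {nonneg R} := NngNum (fine_ge0 (measure_ge0 P A)).
have gS0 : {in [set: g_sigma_algebraType S], forall y, (0 <= (EFin \o g) y)%E}.
  by move=> y _; rewrite lee_fin.
have E1 := ge0_integral_pushforward mh (mrestr P mA) measurableT mgSE gS0.
have E2 := ge0_integral_pushforward mh P measurableT mgSE gS0.
apply: (etrans (esym E1)); rewrite -[X in (X * _)%E](fineK fPA).
apply: (etrans _ (congr1 (mule (fine (P A))%:E) E2)).
rewrite -(@ge0_integral_mscale _ _ _ _ _ _ k)//; last first.
  by move=> y _; rewrite lee_fin.
apply: eq_measure_integral => D mD _.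
by rewrite /= /mscale /pushforward /mrestr /= fineK// setIC indA.
Qed.

Lemma measurable_vertex (d' : measure_display) (T' : measurableType d') n
    (V : T -> 'I_n) (g : 'I_n -> T -> T') :
  (forall v, measurable (V @^-1` [set v])) ->
  (forall v, measurable_fun [set: T] (g v)) ->
  measurable_fun [set: T] (fun w => g (V w) w).
Proof.
move=> mV mg _ A mA; rewrite setTI.
rewrite (_ : _ @^-1` A = \big[setU/set0]_(v < n) (V @^-1` [set v] `&` g v @^-1` A)).
  apply: bigsetU_measurable => v _; apply: measurableI => //.
  by rewrite -[_ @^-1` A]setTI; exact: mg.
rewrite -bigcup_seq; apply/seteqP; split => w /=.
  by move=> gA; exists (V w) => //=; rewrite mem_index_enum.
by case=> v _ [/= -> gA].
Qed.

(** Split the space according to the value v of V: on each piece the integrand is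
    g v, which is independent of V. *)
Lemma uniform_vertex_mean (S : set_system T) n (V : T -> 'I_n.+1)
    (g : 'I_n.+1 -> T -> R) :
  S `<=` measurable ->
  (forall v, measurable (V @^-1` [set v])) ->
  (forall v, P (V @^-1` [set v]) = (n.+1%:R^-1)%:E) ->
  independent P (preimage_set_system [set: T] V [set: set 'I_n.+1]) <<s S >> ->
  (forall v, measurable_fun [set: g_sigma_algebraType S] (g v)) ->
  (forall v w, 0 <= g v w) ->
  (\int[P]_w (g (V w) w)%:E =
     (n.+1%:R^-1)%:E * \sum_(v < n.+1) \int[P]_w (g v w)%:E)%E.
Proof.
move=> Sm mV PV iV mg g0.
have mgT v := g_sigma_measurable_fun Sm (mg v).
have cover : [set: T] = \big[setU/set0]_(v <- index_enum 'I_n.+1) V @^-1` [set v].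
  rewrite -bigcup_seq; apply/seteqP; split => // w _.
  by exists (V w) => //=; rewrite mem_index_enum.
rewrite {1}cover ge0_integral_bigsetU//=.
- rewrite ge0_sume_distrr; last by move=> v _; apply: integral_ge0 => w _;
    rewrite lee_fin.
  apply: eq_bigr => v _; rewrite -(PV v) -(@indep_integral S)//.
  + by apply: eq_integral => w; rewrite inE /= => ->.
  + by move=> D SD; apply: iV => //; exists [set v] => //; rewrite setTI.
- exact: index_enum_uniq.
- by apply/trivIsetP => u v _ _ uv; rewrite -subset0 => w [/= -> vu]; rewrite
    vu eqxx in uv.
- by rewrite -cover; apply/measurable_EFinP; exact: measurable_vertex.
- by move=> w _; rewrite lee_fin.
Qed.

End sub_sigma_algebra.

Lemma measurable_natfun d (T : measurableType d) d' (T' : measurableType d')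
    (f : T -> nat) (g : nat -> T') :
  measurable_fun [set: T] f -> measurable_fun [set: T] (fun w => g (f w)).
Proof. by move=> mf; apply: (@measurableT_comp _ _ _ _ _ _ g). Qed.

Section measurable_pr_iter.
Context d (T : measurableType d) (R : realType) (n : nat)
  (e : 'I_n -> 'I_n -> T -> nat) (C B : 'I_n -> T -> R).
Hypothesis me : forall j i, measurable_fun [set: T] (e j i).
Hypothesis mC : forall i, measurable_fun [set: T] (C i).
Hypothesis mB : forall i, measurable_fun [set: T] (B i).

Lemma measurable_pr_iter N i : measurable_fun [set: T]
  (fun w => pr_iter (fun j i => e j i w) (C^~ w) (B^~ w) N i).
Proof.
elim: N i => [|N IH] i; first exact: measurable_cst.
apply: measurable_funD => //; apply: measurable_sum => j.
apply: measurable_funM => //; apply: measurable_funM.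
  apply: measurable_funM => //.
  exact: (@measurable_natfun _ _ _ R (e j i) (fun k => k%:R)).
apply: (@measurable_natfun _ _ _ R (fun w => \sum_(k < n) e j k w)%N (fun k =>
  k%:R^-1)).
elim: (index_enum _) => [|k s IHs].
  by under eq_fun do rewrite big_nil; exact: measurable_cst.
under eq_fun do rewrite big_cons.
exact: measurable_fun_addn.
Qed.

End measurable_pr_iter.

Section finite_families.
Context (R : realType) (I : finType).

(** Generators of the product sigma-algebra on I -> R. *)
Definition rectangles : set_system (I -> R) := [set D |
  exists2 A : I -> set R, forall i, measurable (A i) &
    D = [set u | forall i, A i (u i)]].

Lemma measurable_coordinate i :
  measurable_fun [set: g_sigma_algebraType rectangles] (fun u => u i).
Proof.
move=> _ A mA; rewrite setTI; apply: sub_sigma_algebra.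
exists (fun j => if j == i then A else setT).
  by move=> j; case: ifP.
apply/seteqP; split => u /=; last by move=> /(_ i); rewrite eqxx.
by move=> uA j; case: eqP => // ->.
Qed.

Lemma measurable_family d (T : measurableType d) (Z : I -> T -> R) :
  (forall i, measurable_fun [set: T] (Z i)) ->
  measurable_fun [set: T] (fun w => Z^~ w : g_sigma_algebraType rectangles).
Proof.
move=> mZ; apply: (@measurability _ _ T (g_sigma_algebraType rectangles) setT _
  rectangles erefl) => _ [_ [A mA ->] <-].
rewrite setTI (_ : _ @^-1` _ = \bigcap_(i in [set: I]) (Z i @^-1` A i)); last first.
  by apply/seteqP; split => w /= => [h i _|h i]; exact: h.
apply: fin_bigcap_measurable => // i _.
by rewrite -[_ @^-1` _]setTI; exact: mZ.
Qed.

(** Rectangles are stable under intersection, so that their probabilities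
    determine the joint law. *)
Lemma family_law d1 (T1 : measurableType d1) (P1 : probability T1 R)
    d2 (T2 : measurableType d2) (P2 : probability T2 R)
    (Z1 : I -> T1 -> R) (Z2 : I -> T2 -> R) (psi : (I -> R) -> R) :
  (forall i, measurable_fun [set: T1] (Z1 i)) ->
  (forall i, measurable_fun [set: T2] (Z2 i)) ->
  (forall A : I -> set R, (forall i, measurable (A i)) ->
    P1 [set w | forall i, A i (Z1 i w)] = P2 [set w | forall i, A i (Z2 i w)]) ->
  measurable_fun [set: g_sigma_algebraType rectangles] psi ->
  (forall u, 0 <= psi u) ->
  (\int[P1]_w (psi (Z1^~ w))%:E = \int[P2]_w (psi (Z2^~ w))%:E)%E.
Proof.
move=> mZ1 mZ2 P12 mpsi psi0.
pose U := g_sigma_algebraType rectangles.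
pose h1 : {RV P1 >-> U} := HB.pack (fun w => Z1^~ w : U)
  (isMeasurableFun.Build _ _ _ _ _ (measurable_family mZ1)).
pose h2 : {RV P2 >-> U} := HB.pack (fun w => Z2^~ w : U)
  (isMeasurableFun.Build _ _ _ _ _ (measurable_family mZ2)).
have mpsiE : measurable_fun [set: U] (EFin \o psi) by exact/measurable_EFinP.
have psi0E u : (0 <= (EFin \o psi) u)%E by rewrite lee_fin.
rewrite -(ge0_integral_distribution h1 mpsiE psi0E).
rewrite -(ge0_integral_distribution h2 mpsiE psi0E).
apply: eq_measure_integral => D mD _.
apply: (@measure_unique _ R U rectangles (fun=> setT) erefl _ _ _ (distribution
  P1 h1) (distribution P2 h2)) => //.
- move=> _ _ [A mA ->] [B mB ->]; exists (fun i => A i `&` B i).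
    by move=> i; exact: measurableI.
  apply/seteqP; split => u /= => [[a b] i|h]; first by split.
  by split => i; have [] := h i.
- by move=> _; exists (fun=> setT) => //; apply/seteqP; split.
- by rewrite bigcup_const//; exists 0%N.
- by move=> _ [A mA ->]; exact: P12.
- by move=> _; apply: le_lt_trans (probability_le1 _ _) (ltry 1).
Qed.

End finite_families.

Section disintegration.
Context d (T : measurableType d) (R : realType) (P : probability T R).

Lemma measurable_countable_fibers (K : T -> nat) :
  (forall k, measurable (K @^-1` [set k])) -> measurable_fun [set: T] K.
Proof.
move=> mK _ A _; rewrite setTI (_ : K @^-1` A = \bigcup_(k in A) K @^-1` [set k]).
  by apply: bigcup_measurable.
by apply/seteqP; split => w /= => [KA|[k Ak ->//]]; exists (K w).
Qed.

Lemma measurable_glue d' (T' : measurableType d') (K : T -> nat) (g : nat -> T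
  -> T') :
  (forall k, measurable (K @^-1` [set k])) ->
  (forall k, measurable_fun [set: T] (g k)) ->
  measurable_fun [set: T] (fun w => g (K w) w).
Proof.
move=> mK mg _ A mA; rewrite setTI.
rewrite (_ : _ @^-1` A = \bigcup_k (K @^-1` [set k] `&` g k @^-1` A)).
  apply: bigcupT_measurable => k; apply: measurableI => //.
  by rewrite -[_ @^-1` A]setTI; exact: mg.
apply/seteqP; split => w /= => [gA|[k _ [-> gA]//]]; by exists (K w).
Qed.

(** On each event K = k, the variable g k is independent of that event: its mean
    can be taken first, with K frozen. *)
Lemma indep_disintegration (S : set_system T) (K : T -> nat) (g : nat -> T -> R) :
  S `<=` measurable ->
  (forall k, measurable (K @^-1` [set k])) ->
  (forall k D, <<s S >> D -> P (K @^-1` [set k] `&` D) = (P (K @^-1` [set k]) *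
    P D)%E) ->
  (forall k, measurable_fun [set: g_sigma_algebraType S] (g k)) ->
  (forall k w, 0 <= g k w <= 1) ->
  (\int[P]_w (g (K w) w)%:E = \int[P]_w (\int[P]_w' g (K w) w')%:E)%E.
Proof.
move=> Sm mK iK mg g01.
have mgT k := g_sigma_measurable_fun Sm (mg k).
have g0 k w : 0 <= g k w by case/andP: (g01 k w).
have cover : [set: T] = \bigcup_k K @^-1` [set k].
  by apply/seteqP; split => // w _; exists (K w).
have triv : trivIset [set: nat] (fun k => K @^-1` [set k]).
  by move=> k l _ _ [w [/= <- <-]].
have ig k : P.-integrable setT (EFin \o g k).
  apply: (@bounded_integrable _ _ _ _ _ 1) => // w.
  by case/andP: (g01 k w) => ? ?; rewrite ger0_norm.
have fiberwise (f : T -> R) : measurable_fun [set: T] f -> (forall w, 0 <= f w) ->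
    (\int[P]_w (f w)%:E = \sum_(k <oo) \int[P]_(w in K @^-1` [set k]) (f w)%:E)%E.
  move=> mf f0; rewrite cover ge0_integral_bigcup//.
    by rewrite -cover; exact/measurable_EFinP.
  by move=> w _; rewrite lee_fin.
rewrite !fiberwise.
- apply: eq_eseriesr => k _.
  transitivity (\int[P]_(w in K @^-1` [set k]) (g k w)%:E)%E.
    by apply: eq_integral => w; rewrite inE /= => ->.
  rewrite (@indep_integral _ _ _ _ S)//; last exact: iK.
  transitivity (\int[P]_(w in K @^-1` [set k]) (\int[P]_w' g k w')%:E)%E; last
    first.
    by apply: eq_integral => w; rewrite inE /= => ->.
  rewrite integral_cst// muleC /Rintegral fineK//.
  exact: integrable_fin_num measurableT _ (ig k).
- exact: (@measurable_natfun _ _ _ R K (fun k => \int[P]_w' g k w')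
    (measurable_countable_fibers mK)).
- by move=> w; apply: Rintegral_ge0.
- exact: measurable_glue.
- by [].
Qed.

End disintegration.

(** * Finite neighborhoods determine the truncated rank *)

(** An isomorphism of neighborhoods only has to match marks inside of them. *)
Lemma pr_iter_local (R : realType) (X : pointedType) (K N n m : nat)
    (g : 'I_n -> 'I_n -> nat) (h : 'I_m -> 'I_m -> nat)
    (x : 'I_n -> X) (y : 'I_m -> X) (v : 'I_n) (u : 'I_m)
    (C B : 'I_n -> R) (C' B' : 'I_m -> R) (f : nat -> nat) :
  let G := ord_mgraph g x v in let H := ord_mgraph h y u in
  (N <= K)%N ->
  set_bij (nbhd_vertex K G) (nbhd_vertex K H) f ->
  {in nbhd_vertex K G &, forall i j, nbhd_mult K H (f i) (f j) = nbhd_mult K G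
    i j} ->
  f (Defs.root G) = Defs.root H ->
  {in nbhd_vertex K G, forall i, mark H (f i) = mark G i} ->
  (forall (i : 'I_n) (j : 'I_m), (i : nat) \in nbhd_vertex K G -> f i = j ->
     C' j = C i /\ B' j = B i) ->
  pr_iter h C' B' N u = pr_iter g C B N v.
Proof.
move=> G H NK fb fe fr fm fCB.
rewrite -(@mg_iter_ord _ _ _ g x v C B _ _ N v (ord_extE C) (ord_extE B)).
rewrite -(@mg_iter_ord _ _ _ h y u C' B' _ _ N u (ord_extE C') (ord_extE B')).
have ff i : i \in nbhd_vertex K G ->
    exists (i' : 'I_n) (j' : 'I_m), i = i' /\ f i = j'.
  move=> /set_mem Gi; have ni : (i < n)%N := nbhd_sub Gi.
  have mi : (f i < m)%N by apply: (@nbhd_sub _ K H); case: fb => + _ _; apply.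
  by exists (Ordinal ni), (Ordinal mi).
apply: (mg_iter_local (G := G) (H := H) NK fb fe fr fm) => i iG;
  have [i' [j' [ii fij]]] := ff i iG; rewrite fij ii !ord_extE;
  by have [] := fCB i' j' _ _; rewrite -?ii.
Qed.

Section marked_rank.
Context (R : realType).

Definition marked_rank (N : nat) (G : mgraph (R * R)%type) : R :=
  mg_iter G (fst \o xmark G) (snd \o xmark G) N (Defs.root G).

Lemma marked_rank_local (N K : nat) (G H : mgraph (R * R)%type) : (N <= K)%N ->
  miso (nbhd K G) (nbhd K H) -> marked_rank N G = marked_rank N H.
Proof.
move=> NK [f fb [fe fr fm fx]].
apply/esym/(mg_iter_local NK fb fe fr fm) => i iG /=;
  by rewrite [xmark H (f i)](fx i iG).
Qed.

Lemma marked_rank_ord (N n : nat) (g : 'I_n -> 'I_n -> nat) (C B : 'I_n -> R) v :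
  marked_rank N (lwrepr (lwclass R (ord_mgraph g (fun i => (C i, B i)) v))) =
  pr_iter g C B N v.
Proof.
rewrite (marked_rank_local (leqnSn N) (lwrepr_nbhd _ _ _))//.
by apply: mg_iter_ord => j /=; rewrite valK.
Qed.

Lemma marked_rank_continuous (N : nat) (phi : R -> R) :
  continuous (fun x : lwspace R (R * R)%type => phi (marked_rank N (lwrepr x))).
Proof.
apply: (@local_continuous _ _ _ N.+1) => // x y xy.
by rewrite (marked_rank_local (leqnSn N) xy).
Qed.

End marked_rank.

(** Mutual independence, which is about finite sets of indices, for families that
    are indexed through an injection. *)
Lemma mutually_independent_injective d (T : measurableType d) (R : realType)
    (P : probability T R) (I : choiceType) (F : I -> set_system T)
    (J : finType) (s : J -> I) (A : J -> set T) :
  mutually_independent P F -> injective s -> (forall j, F (s j) (A j)) ->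
  P [set w | forall j, A j w] = (\prod_(j : J) P (A j))%E.
Proof.
move=> iF sinj FA.
pose A' i := if [pick j | s j == i] is Some j then A j else setT.
have A's j : A' (s j) = A j.
  rewrite /A'; case: pickP => [k /eqP/sinj -> //|/(_ j)].
  by rewrite eqxx.
have mem i : (i \in [fset i in [seq s j | j <- enum J]]%fset) = (i \in [seq s j
  | j <- enum J]).
  by rewrite !inE.
have := iF [fset i in [seq s j | j <- enum J]]%fset A'.
have FA' i : i \in [fset i in [seq s j | j <- enum J]]%fset -> F i (A' i).
  by rewrite mem => /mapP[j _ ->]; rewrite A's.
move=> /(_ FA').
have -> : \bigcap_(i in [set` [fset i in [seq s j | j <- enum J]]%fset]) A' i =
    [set w | forall j, A j w].
  apply/seteqP; split => w /=.
    move=> h j; rewrite -A's; apply: h => /=; rewrite mem; apply: map_f.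
    by rewrite mem_enum.
  by move=> h i /=; rewrite mem => /mapP[j _ ->]; rewrite A's.
move=> ->.
rewrite (perm_big [seq s j | j <- enum J])/=.
  by rewrite big_map big_enum/=; apply: eq_bigr => j _; rewrite A's.
apply: uniq_perm => [||i]; last exact: mem.
- exact: fset_uniq.
- by rewrite map_inj_uniq// enum_uniq.
Qed.

Section iid_marks.
Context (R : realType) (d : nat -> measure_display)
  (T : forall n, measurableType (d n)) (P : forall n, probability (T n) R)
  (C B : forall n, 'I_n.+1 -> {RV (P n) >-> R}).
Arguments C : clear implicits.
Arguments B : clear implicits.
Hypothesis iidC : iid_array P (fun n => C n).
Hypothesis iidB : iid_array P (fun n => B n).
Hypothesis iCB : forall n, independent (P n) (sigma_rv (C n)) (sigma_rv (B n)).

(** The right-hand side depends neither on n nor on the choice s of the vertices: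
    this is how laws are compared between graphs of different sizes. *)
Lemma iid_rectangle n (I : finType) (s : I -> 'I_n.+1) (A : I + I -> set R) :
  injective s -> (forall z, measurable (A z)) ->
  (P n [set w | forall z, A z (match z with inl j => C n (s j) w
                               | inr j => B n (s j) w end)] =
   \prod_(j : I) P 0%N (C 0%N ord0 @^-1` A (inl j)) *
   \prod_(j : I) P 0%N (B 0%N ord0 @^-1` A (inr j)))%E.
Proof.
move=> sinj mA.
pose D1 := [set w | forall j : I, (C n (s j) @^-1` A (inl j)) w].
pose D2 := [set w | forall j : I, (B n (s j) @^-1` A (inr j)) w].
rewrite (_ : [set w | _] = D1 `&` D2); last first.
  apply/seteqP; split => w /=.
    by move=> h; split => j; [exact: (h (inl j))|exact: (h (inr j))].
  by move=> [h1 h2] [j|j]; [exact: h1|exact: h2].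
have bigI (Y : forall n, 'I_n.+1 -> T n -> R) (A' : I -> set R) :
    (forall j, measurable (A' j)) ->
    sigma_rv (Y n) [set w | forall j : I, (Y n (s j) @^-1` A' j) w].
  move=> mA'.
  have -> : [set w | forall j : I, (Y n (s j) @^-1` A' j) w] =
      \bigcap_(j in [set: I]) (Y n (s j) @^-1` A' j).
    by apply/seteqP; split => w /= => [h i _|h i]; exact: h.
  apply: (@fin_bigcap_measurable _ (g_sigma_algebraType
     (\bigcup_i preimage_set_system [set: T n] (Y n i) measurable))) => // j _.
  exact: sigma_rv_preimage.
rewrite iCB; [|exact: (bigI (fun n => C n))|exact: (bigI (fun n => B n))].
congr (_ * _)%E.
- rewrite (mutually_independent_injective (iidC.1 n) sinj); last first.
    by move=> j; exists (A (inl j)) => //; rewrite setTI.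
  by apply: eq_bigr => j _; exact: iidC.2.
- rewrite (mutually_independent_injective (iidB.1 n) sinj); last first.
    by move=> j; exists (A (inr j)) => //; rewrite setTI.
  by apply: eq_bigr => j _; exact: iidB.2.
Qed.

Variable phi : R -> R.
Hypothesis mphi : measurable_fun [set: R] phi.
Hypothesis phi01 : forall y, 0 <= phi y <= 1.

(** The graph g is frozen, the mean is over the marks only. *)
Definition quenched_mean (N n : nat) (g : 'I_n.+1 -> 'I_n.+1 -> nat) (v :
  'I_n.+1) : R :=
  \int[P n]_w phi (pr_iter g (fun i => C n i w) (fun i => B n i w) N v).

(** The truncated rank of v is a function psi of the marks found in the
    neighborhood of v, and the isomorphism f turns the truncated rank of u into
    the same psi of the marks of the image vertices; both families of marks are
    i.i.d. with the same law. *)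
Lemma quenched_mean_local (N K n m : nat) (g : 'I_n.+1 -> 'I_n.+1 -> nat)
    (h : 'I_m.+1 -> 'I_m.+1 -> nat) (v : 'I_n.+1) (u : 'I_m.+1) :
  (N <= K)%N ->
  miso (nbhd K (ord_mgraph g (fun=> tt) v)) (nbhd K (ord_mgraph h (fun=> tt) u)) ->
  quenched_mean N g v = quenched_mean N h u.
Proof.
set G := ord_mgraph g _ _; set H := ord_mgraph h _ _.
move=> NK [f fb [fe fr fm _]].
pose I : finType := {j : 'I_n.+1 | (j : nat) \in nbhd_vertex K G}.
pose s (j : I) : 'I_n.+1 := val j.
pose s' (j : I) : 'I_m.+1 := inord (f (s j)).
have fm' (j : I) : (f (s j) < m.+1)%N.
  apply: (@nbhd_sub _ K H); case: fb => + _ _; apply.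
  exact/set_mem/(valP j).
have s'E (j : I) : (s' j : nat) = f (s j) by rewrite inordK.
have sinj : injective s by exact: val_inj.
have s'inj : injective s'.
  move=> j k /(congr1 (@nat_of_ord _)); rewrite !s'E => fjk.
  apply/val_inj/val_inj; case: fb => _ + _; apply; [exact: (valP j)|exact:
    (valP k)|exact: fjk].
pose U (w : I + I -> R) (z : I -> I + I) (i : 'I_n.+1) : R := oapp (fun j => w
  (z j)) 0 (insub i).
(* outside of the neighborhood the marks may be replaced by 0 *)
pose psi w := phi (pr_iter g (U w inl) (U w inr) N v).
have Us (w : I + I -> R) z (i : 'I_n.+1) (iG : (i : nat) \in nbhd_vertex K G) :
    U w z i = w (z (Sub i iG)).
  by rewrite /U insubT.
have mpsi : measurable_fun [set: g_sigma_algebraType (@rectangles R (I +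
  I)%type)] psi.
  apply: (@measurableT_comp _ _ _ _ _ _ phi) => //.
  have mU z i : measurable_fun [set: g_sigma_algebraType (@rectangles R (I +
    I)%type)]
      (fun w => U w z i).
    rewrite /U; case: insub => [j|] /=; first exact: measurable_coordinate.
    exact: measurable_cst.
  exact: (@measurable_pr_iter _ (g_sigma_algebraType (@rectangles R (I + I)%type)) R
    n.+1 (fun j i _ => g j i) (fun i w => U w inl i) (fun i w => U w inr i)
    (fun j i => @measurable_cst _ _ _ _ _ (g j i)) (mU inl) (mU inr) N v).
pose Z1 (z : I + I) (w : T n) := match z with inl j => C n (s j) w | inr j => B
  n (s j) w end.
pose Z2 (z : I + I) (w : T m) := match z with inl j => C m (s' j) w | inr j =>
  B m (s' j) w end.
have e1 w : phi (pr_iter g (fun i => C n i w) (fun i => B n i w) N v) = psi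
  (Z1^~ w).
  rewrite /psi; congr phi; apply/esym.
  apply: (@pr_iter_local _ _ K _ _ _ _ _ (fun=> tt) (fun=> tt) _ _ _ _ _ _ id)
    => //.
    by split => // i Gi; exists i.
  by move=> i _ iG /val_inj <-; rewrite !(Us _ _ _ iG).
have e2 w : phi (pr_iter h (fun i => C m i w) (fun i => B m i w) N u) = psi
  (Z2^~ w).
  rewrite /psi; congr phi.
  apply: (@pr_iter_local _ _ K _ _ _ _ _ (fun=> tt) (fun=> tt) _ _ _ _ _ _ f) => //.
  move=> i j iG fij; rewrite !(Us _ _ _ iG) /Z2.
  have -> : s' (Sub i iG) = j by apply: val_inj; rewrite /= inordK fij.
  by [].
rewrite /quenched_mean /Rintegral; congr fine.
under eq_integral do rewrite e1.
under [RHS]eq_integral do rewrite e2.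
apply: family_law => //.
- by case=> j.
- by case=> j.
- by move=> A mA; rewrite !iid_rectangle.
- by move=> w; case/andP: (phi01 (pr_iter g (U w inl) (U w inr) N v)).
Qed.

End iid_marks.

(** * Convergence in probability *)

Section deviations.
Context d (T : measurableType d) (R : realType) (P : probability T R).

Lemma measurable_deviation (Y : T -> R) (l a : R) : measurable_fun [set: T] Y ->
  measurable [set w | a < `|Y w - l|].
Proof.
move=> mY; rewrite (_ : [set w | _] = (fun w => `|Y w - l|) @^-1` `]a, +oo[);
  last first.
  by apply/seteqP; split => w /=; rewrite in_itv/= andbT.
rewrite -[_ @^-1` _]setTI; apply: measurableT_comp => //; exact: measurable_funB.
Qed.

Lemma measurable_le_set (Y : T -> R) (a : R) : measurable_fun [set: T] Y ->
  measurable [set w | Y w <= a].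
Proof.
move=> mY; rewrite (_ : [set w | _] = Y @^-1` `]-oo, a]).
  by rewrite -[_ @^-1` _]setTI; exact: mY.
by apply/seteqP; split => w /=; rewrite in_itv.
Qed.

(** Markov's inequality, in the shape of a deviation from 0. *)
Lemma mean_deviation (Y : T -> R) (a k : R) : measurable_fun [set: T] Y ->
  (forall w, 0 <= Y w) -> 0 < a -> (\int[P]_w (Y w)%:E <= k%:E)%E ->
  (P [set w | (a < `|Y w - 0|)%R] <= (k / a)%:E)%E.
Proof.
move=> mY Y0 a0 Yk; set E := [set w | _].
have mE : measurable E by exact: measurable_deviation.
rewrite EFinM muleC lee_pdivlMl//; apply: le_trans Yk.
rewrite -[X in P X]setIT -integral_indic// -ge0_integralZl_EFin//; last 2 first.
- by apply/measurable_EFinP; exact: measurable_indic.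
- exact: ltW.
apply: ge0_le_integral => //.
- by move=> w _; rewrite mule_ge0// lee_fin ltW.
- by apply: emeasurable_funM => //; apply/measurable_EFinP; exact: measurable_indic.
- exact/measurable_EFinP.
- move=> w _; rewrite -EFinM lee_fin indicE; have [|_] := boolP (w \in E); last
    by rewrite mulr0.
  by rewrite inE /E /= subr0 mulr1 ger0_norm// => /ltW.
Qed.

(** The events r - 1/(k+1) < Z <= r + 1/(k+1) decrease to Z = r, which is null. *)
Lemma cdf_local_jump (Z : T -> R) (r eps : R) : measurable_fun [set: T] Z ->
  P [set w | Z w = r] = 0%E -> 0 < eps ->
  exists2 delta : R, 0 < delta &
    fine (P [set w | Z w <= r + delta]) <= fine (P [set w | Z w <= r - delta])
      + eps.
Proof.
move=> mZ Pr eps0.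
pose F (k : nat) := [set w | Z w <= r + k.+1%:R^-1] `\` [set w | Z w <= r -
  k.+1%:R^-1].
have mF k : measurable (F k) by apply: measurableD; exact: measurable_le_set.
have bigF : \bigcap_k F k = [set w | Z w = r].
  apply/seteqP; split => w /=.
    move=> h; apply/eqP; rewrite eq_le; apply/andP; split; rewrite leNgt;
      apply/negP.
      move=> /ltr_add_invr[k rk]; have [/= Zk _] := h k Logic.I.
      by move: rk; rewrite ltNge Zk.
    move=> /ltr_add_invr[k rk]; have [/= _] := h k Logic.I; apply.
    by rewrite lerBrDr ltW.
  move=> Zr k _; split => /=; rewrite Zr; first by rewrite lerDl.
  by apply/negP; rewrite -ltNge ltrBlDr ltrDl invr_gt0.
have cF : P (F k) @[k --> \oo] --> 0%E.
  rewrite -Pr -bigF; apply: nonincreasing_cvg_mu => //.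
  - by rewrite (le_lt_trans (probability_le1 P _)) ?ltry.
  - exact: bigcap_measurable.
  - move=> k l kl; apply/subsetPset => w [/= h1 h2].
    have kl' : l.+1%:R^-1 <= k.+1%:R^-1 :> R by rewrite lef_pV2 ?posrE// ler_nat.
    split => /=; first by rewrite (le_trans h1)// lerD2l.
    by move=> h; apply: h2; rewrite (le_trans h)// lerD2l lerN2.
have [k _ /(_ k (leqnn k))] : \forall k \near \oo, fine (P (F k)) < eps.
  by apply: cvgr_lt eps0; apply: (@fine_cvg _ _ _ _ (fun k => P (F k))).
move=> Fk; exists k.+1%:R^-1; first by rewrite invr_gt0.
have mle a : measurable [set w | Z w <= a] by exact: measurable_le_set.
rewrite -lerBlDl -fineB ?fin_num_measure//.
apply: le_trans (ltW Fk); rewrite /F measureD//; last first.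
  by rewrite (le_lt_trans (probability_le1 P _)) ?ltry.
rewrite setIidr// => w /= h; rewrite (le_trans h)// lerD2l.
by rewrite (@le_trans _ _ 0)// ?oppr_le0 invr_ge0.
Qed.

End deviations.

Section in_probability.
Context (R : realType) (d : nat -> measure_display)
  (T : forall n, measurableType (d n)) (P : forall n, probability (T n) R)
  (Y : forall n, T n -> R) (l : R).
Arguments Y : clear implicits.
Hypothesis mY : forall n, measurable_fun [set: T n] (Y n).

Lemma eq_cvg_in_probability (Y' : forall n, T n -> R) :
  (forall n w, Y n w = Y' n w) ->
  cvg_in_probability P Y' l -> cvg_in_probability P Y l.
Proof.
move=> YY' cY' eps eps0.
rewrite (_ : (fun n => P n _) = (fun n => P n [set w | eps < `|Y' n w - l|])).
  exact: cY'.
by apply/funext => n; congr (P n _); apply/seteqP; split => w /=; rewrite YY'.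
Qed.

Lemma in_probabilityP : cvg_in_probability P Y l <->
  forall eps eta : R, 0 < eps -> 0 < eta ->
    \forall n \near \oo, (P n [set w | (eps < `|Y n w - l|)%R] <= eta%:E)%E.
Proof.
have mD n (eps : R) : measurable [set w | eps < `|Y n w - l|].
  exact: measurable_deviation.
split=> [cY eps eta eps0 eta0|H eps eps0].
  have /fine_cvg/cvgr_le /(_ eta eta0) := cY eps eps0.
  by apply: filterS => n /=; rewrite -lee_fin fineK// fin_num_measure.
apply: (@cvg_EFin _ _ _ _ (fun n => P n [set w | eps < `|Y n w - l|])).
  by apply: nearW => n; rewrite fin_num_measure.
apply/cvgrPdist_le => eta eta0; have := H eps eta eps0 eta0.
apply: filterS => n /=.
rewrite sub0r normrN ger0_norm ?fine_ge0//.
by rewrite -lee_fin fineK ?fin_num_measure.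
Qed.

(** Bounded convergence: |Y - l| <= eps outside of an event of small probability,
    and is at most 1 + |l| on it. *)
Lemma in_probability_mean : (forall n w, 0 <= Y n w <= 1) ->
  cvg_in_probability P Y l -> \int[P n]_w Y n w @[n --> \oo] --> l.
Proof.
move=> Y01 /in_probabilityP cY.
apply/cvgrPdist_le => eps eps0.
have M0 : 0 < 1 + `|l| by rewrite ltr_pwDl.
have e2 : 0 < eps / 2 by rewrite divr_gt0.
have e3 : 0 < eps / 2 / (1 + `|l|) by rewrite divr_gt0.
have := cY _ _ e2 e3; apply: filterS => n /=.
set E := [set w | _] => PE.
have mE : measurable E by exact: measurable_deviation.
have YM w : `|Y n w - l| <= 1 + `|l|.
  rewrite (le_trans (ler_normB _ _))// lerD2r.
  by case/andP: (Y01 n w) => ? ?; rewrite ger0_norm.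
have iY : (P n).-integrable setT (EFin \o Y n).
  apply: (@bounded_integrable _ _ _ _ _ 1) => // w.
  by case/andP: (Y01 n w) => ? ?; rewrite ger0_norm.
have iD : (P n).-integrable setT (EFin \o (fun w => Y n w - l)).
  apply: (@bounded_integrable _ _ _ _ _ (1 + `|l|)) => //.
  exact: measurable_funB.
have iE : (P n).-integrable setT (EFin \o (fun w => \1_E w : R)).
  apply: (@bounded_integrable _ _ _ _ _ 1) => [|w]; first exact: measurable_indic.
  by rewrite indicE ger0_norm ?ler0n//; case: (_ \in _).
have iME : (P n).-integrable setT (EFin \o (fun w => (1 + `|l|) * \1_E w)).
  exact: (integrableZl measurableT _ iE).
rewrite distrC -[X in _ - X](Rintegral_prob_cst (P n)) -RintegralB//; last
  exact: integrable_cst.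
rewrite (le_trans (le_normr_Rintegral _ iD))//.
apply: (@le_trans _ _ (\int[P n]_w (eps / 2 + (1 + `|l|) * \1_E w))).
  apply: le_Rintegral => //; first exact: integrable_norm.
    exact: eq_integrable (integrableD measurableT (integrable_cst _ (eps / 2)) iME).
  move=> w _; rewrite indicE; have [_|] := boolP (w \in E).
    by rewrite mulr1 (le_trans (YM w))// lerDr ltW.
  by move/negP; rewrite inE /E /= => /negP; rewrite -leNgt mulr0 addr0.
rewrite RintegralD//; last exact: integrable_cst.
rewrite Rintegral_prob_cst RintegralZl// {2}(splitr eps) lerD2l mulrC
  -ler_pdivlMr//.
rewrite -lee_fin /Rintegral fineK; last exact: integrable_fin_num measurableT _ iE.
by rewrite integral_indic// setIT.
Qed.

End in_probability.

(** * Pagerank of random graphs *)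

Lemma cvgn_uniform_approx (R : realType) (u : nat -> R) (v : nat -> nat -> R)
    (eps : nat -> R) :
  (forall N, cvgn (v N)) -> (forall N n, `|u n - v N n| <= eps N) ->
  eps N @[N --> \oo] --> 0 -> cvgn u.
Proof.
move=> cv uv eps0; apply: cauchy_cvg; apply: cauchy_exP => e /= e0.
have e2 : 0 < e / 2 by rewrite divr_gt0.
have [N _ /(_ N (leqnn N))] := cvgr_lt _ eps0 _ e2 => eN.
exists (lim (v N n @[n --> \oo])).
have /cvgrPdist_lt /(_ _ e2) := cv N; apply: filterS => n /= vn.
rewrite /ball /=; apply: (le_lt_trans (ler_distD (v N n) _ _)).
by rewrite (splitr e) ltrD// distrC (le_lt_trans (uv N n)).
Qed.

(** The bounds pass to the limit, which is therefore a real number. *)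
Lemma cvgn_EFin_bounded (R : realType) (u : nat -> R) (l : \bar R) :
  (forall n, 0 <= u n <= 1) -> (u n)%:E @[n --> \oo] --> l -> cvgn u.
Proof.
move=> u01 ul.
have l0 : (0%:E <= l)%E.
  rewrite -(cvg_lim (@ereal_hausdorff R) ul); apply: lime_ge.
    by apply/cvg_ex; exists l.
  by apply: nearW => n; rewrite lee_fin; case/andP: (u01 n).
have l1 : (l <= 1%:E)%E.
  rewrite -(cvg_lim (@ereal_hausdorff R) ul); apply: lime_le.
    by apply/cvg_ex; exists l.
  by apply: nearW => n; rewrite lee_fin; case/andP: (u01 n).
have lfin : l \is a fin_num.
  by rewrite ge0_fin_numE// (le_lt_trans l1)// ltry.
by apply/cvg_ex; exists (fine l); apply: (@fine_cvg _ _ _ _ (fun n => (u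
  n)%:E)); rewrite fineK.
Qed.

Section pagerank_of_random_graphs.
Context (R : realType) (d : nat -> measure_display)
  (T : forall n, measurableType (d n)) (P : forall n, probability (T n) R)
  (e : forall n, 'I_n.+1 -> 'I_n.+1 -> {RV (P n) >-> nat})
  (C B : forall n, 'I_n.+1 -> {RV (P n) >-> R})
  (V : forall n, T n -> 'I_n.+1)
  (PR : forall n, T n -> 'I_n.+1 -> R) (c : R).
Arguments e : clear implicits.
Arguments C : clear implicits.
Arguments B : clear implicits.
Arguments V : clear implicits.
Arguments PR : clear implicits.
Let sigmaG n := sigma_rv (fun ji => e n ji.1 ji.2).
Let sigmaC n := sigma_rv (C n).
Let sigmaB n := sigma_rv (B n).
Arguments sigmaG : clear implicits.
Arguments sigmaC : clear implicits.
Arguments sigmaB : clear implicits.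
Let S n := sigmaG n `|` sigmaC n `|` sigmaB n.
Arguments S : clear implicits.
Hypothesis c1 : c < 1.
Hypothesis Cc : forall n i w, 0 <= C n i w <= c.
Hypothesis B0 : forall n i w, 0 <= B n i w.
Hypothesis EB : forall n i, ('E_(P n)[B n i] = (1 - c)%:E)%E.
Hypothesis PRP : forall n w, is_pagerank (fun j i => e n j i w)
  (fun i => C n i w) (fun i => B n i w) (PR n w).
Hypothesis mV : forall n v, measurable (V n @^-1` [set v]).
Hypothesis PV : forall n v, P n (V n @^-1` [set v]) = (n.+1%:R^-1)%:E.
Hypothesis iV : forall n, independent (P n)
  (preimage_set_system [set: T n] (V n) [set: set 'I_n.+1]) <<s S n >>.

Arguments Cc : clear implicits.
Arguments B0 : clear implicits.
Arguments EB : clear implicits.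
Arguments PRP : clear implicits.
Arguments mV : clear implicits.
Arguments PV : clear implicits.
Arguments iV : clear implicits.

Let c0 : 0 <= c.
Proof.
have := Cc 0%N ord0 point; case/andP => h1 h2; exact: le_trans h1 h2.
Qed.

Definition truncated_rank (N n : nat) (v : 'I_n.+1) (w : T n) : R :=
  pr_iter (fun j i => e n j i w) (fun i => C n i w) (fun i => B n i w) N v.
Arguments truncated_rank : clear implicits.
Notation rk := truncated_rank.

Let rk_ge0 N n v w : 0 <= rk N n v w.
Proof. exact: (pr_iter_ge0 _ (Cc n ^~ w) (B0 n ^~ w)). Qed.

Let rk_le N n v w : rk N n v w <= PR n w v.
Proof. exact: (pr_iter_le c0 c1 (Cc n ^~ w) (B0 n ^~ w) (PRP n w)). Qed.

Let PR_ge0 n v w : 0 <= PR n w v.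
Proof. exact: le_trans (@rk_ge0 0%N n v w) (@rk_le 0%N n v w). Qed.

Let Sm n : S n `<=` measurable.
Proof.
by move=> D [[|]|]; apply: sigma_rv_measurable => i; exact: measurable_funP.
Qed.

Let measurable_rk N n v : measurable_fun [set: g_sigma_algebraType (S n)] (rk N
  n v).
Proof.
apply: (@measurable_pr_iter _ (g_sigma_algebraType (S n)) R n.+1
  (fun j i => e n j i) (fun i => C n i) (fun i => B n i)).
- move=> j i _ A mA; rewrite setTI; apply: sub_sigma_algebra; left; left.
  exact (@sigma_rv_preimage _ (T n) _ _ _ (fun ji : 'I_n.+1 * 'I_n.+1 => e n
    ji.1 ji.2) (j, i) A mA).
- move=> i _ A mA; rewrite setTI; apply: sub_sigma_algebra; left; right.
  exact (@sigma_rv_preimage _ (T n) _ _ _ (fun i => C n i) i A mA).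
- move=> i _ A mA; rewrite setTI; apply: sub_sigma_algebra; right.
  exact (@sigma_rv_preimage _ (T n) _ _ _ (fun i => B n i) i A mA).
Qed.

Let measurable_PR n v : measurable_fun [set: g_sigma_algebraType (S n)] (fun w
  => PR n w v).
Proof.
apply: (@measurable_fun_cvg _ (g_sigma_algebraType (S n)) R setT (fun N => rk N
  n v)) => [N|w _].
  exact: measurable_rk.
exact: (cvg_pr_iter c0 c1 (Cc n ^~ w) (PRP n w)).
Qed.

Let measurable_rkT N n v : measurable_fun [set: T n] (rk N n v).
Proof. exact: g_sigma_measurable_fun (@Sm n) (@measurable_rk N n v). Qed.

Let measurable_PRT n v : measurable_fun [set: T n] (fun w => PR n w v).
Proof. exact: g_sigma_measurable_fun (@Sm n) (@measurable_PR n v). Qed.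

Let measurable_PRV n : measurable_fun [set: T n] (fun w => PR n w (V n w)).
Proof.
exact: (@measurable_vertex _ (T n) _ _ _ (V n) (fun v w => PR n w v) (mV n)).
Qed.

Let measurable_rkV N n : measurable_fun [set: T n] (fun w => rk N n (V n w) w).
Proof.
exact: (@measurable_vertex _ (T n) _ _ _ (V n) (rk N n) (mV n)).
Qed.

(** The bound (1 - c)^-1 * total of B on the total pagerank has mean n + 1, as the
    B_i have mean 1 - c. *)
Let l1_mean n (k : R) (q : 'I_n.+1 -> T n -> R) : 0 <= k ->
  (forall v, measurable_fun [set: T n] (q v)) -> (forall v w, 0 <= q v w) ->
  (forall w, \sum_(v < n.+1) q v w <= k * ((1 - c)^-1 * \sum_(v < n.+1) B n v w)) ->
  ((n.+1%:R^-1)%:E * \sum_(v < n.+1) \int[P n]_w (q v w)%:E <= k%:E)%E.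
Proof.
move=> k0 mq q0 qB.
rewrite -ge0_integral_sum//; last 2 first.
- by move=> v; exact/measurable_EFinP.
- by move=> v w _; rewrite lee_fin.
have mB v : measurable_fun [set: T n] (B n v) by exact: measurable_funP.
have k1 : 0 <= k * (1 - c)^-1 by rewrite mulr_ge0// invr_ge0 subr_ge0 ltW.
apply: (@le_trans _ _ ((n.+1%:R^-1)%:E *
    \int[P n]_w ((k * (1 - c)^-1)%:E * \sum_(v < n.+1) (B n v w)%:E))%E).
  rewrite lee_pmul2l//; apply: ge0_le_integral => //.
  - by move=> w _; apply: sume_ge0 => v _; rewrite lee_fin.
  - by apply: emeasurable_sum => v; exact/measurable_EFinP.
  - apply: emeasurable_funM => //; apply: emeasurable_sum => v;
      exact/measurable_EFinP.
  - by move=> w _; rewrite !sumEFin -EFinM lee_fin -mulrA.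
rewrite ge0_integralZl//; last 2 first.
- by apply: emeasurable_sum => v; exact/measurable_EFinP.
- by move=> w _; apply: sume_ge0 => v _; rewrite lee_fin.
rewrite ge0_integral_sum//; last 2 first.
- by move=> v; exact/measurable_EFinP.
- by move=> v w _; rewrite lee_fin.
rewrite (eq_bigr (fun=> (1 - c)%:E)); last first.
  by move=> v _; rewrite -(EB n v) unlock.
rewrite sumEFin sumr_const card_ord -!EFinM lee_fin -[(1 - c) *+ _]mulr_natr.
rewrite le_eqVlt; apply/orP; left; apply/eqP.
have hn : (n.+1%:R : R) != 0 by rewrite pnatr_eq0.
have hc : 1 - c != 0 by rewrite subr_eq0 gt_eqF.
by rewrite [X in _ * X = _]mulrA (divfK hc) mulrC mulfK.
Qed.

Let mean_PRV n : ('E_(P n)[fun w => PR n w (V n w)] <= 1)%E.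
Proof.
rewrite unlock (uniform_vertex_mean (S := S n) (g := fun v w => PR n w v))//.
- apply: (@l1_mean n 1) => // w; rewrite mul1r.
  exact: (sum_pagerank_le c0 c1 (Cc n ^~ w) (B0 n ^~ w) (PRP n w)).
Qed.

Let mean_gap N n : ((n.+1%:R^-1)%:E *
   \sum_(v < n.+1) \int[P n]_w (PR n w v - rk N n v w)%:E <= (c ^+ N)%:E)%E.
Proof.
apply: (@l1_mean n) => //.
- exact: exprn_ge0.
- by move=> v; exact: measurable_funB.
- by move=> v w; rewrite subr_ge0.
- move=> w; exact: (sum_pr_iter_error c0 c1 (Cc n ^~ w) (B0 n ^~ w) (PRP n w)).
Qed.

Let mean_gapV N n : (\int[P n]_w (PR n w (V n w) - rk N n (V n w) w)%:E <= (c
  ^+ N)%:E)%E.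
Proof.
rewrite (uniform_vertex_mean (S := S n) (g := fun v w => PR n w v - rk N n v w))//.
- by move=> v; apply: measurable_funB; [exact: measurable_PR|exact: measurable_rk].
- by move=> v w; rewrite subr_ge0.
Qed.

(** A ramp is 1/eps-Lipschitz and the truncation error has mean at most c^N. *)
Let ramp_gap x eps N n : 0 < eps ->
  `|\int[P n]_w ramp x eps (PR n w (V n w)) - \int[P n]_w ramp x eps (rk N n (V
    n w) w)|
  <= c ^+ N / eps.
Proof.
move=> eps0.
have i1 : (P n).-integrable setT (EFin \o (fun w => ramp x eps (PR n w (V n w)))).
  exact: integrable_ramp.
have i2 : (P n).-integrable setT (EFin \o (fun w => ramp x eps (rk N n (V n w) w))).
  exact: integrable_ramp.
have mD : measurable_fun [set: T n] (fun w => PR n w (V n w) - rk N n (V n w) w).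
  exact: measurable_funB.
have D0 w : 0 <= PR n w (V n w) - rk N n (V n w) w by rewrite subr_ge0.
have i3 : (P n).-integrable setT (EFin \o (fun w => PR n w (V n w) - rk N n (V
  n w) w)).
  apply/integrableP; split; first exact/measurable_EFinP.
  apply: (le_lt_trans _ (ltry (c ^+ N))); apply: le_trans _ (mean_gapV N n).
  rewrite le_eqVlt; apply/orP; left; apply/eqP; apply: eq_integral => w _ /=.
  by rewrite ger0_norm.
rewrite distrC ger0_norm; last first.
  by rewrite subr_ge0; apply: le_Rintegral => // w _; exact: ramp_anti.
rewrite lerBlDl.
have i4 : (P n).-integrable setT
    (EFin \o (fun w => eps^-1 * (PR n w (V n w) - rk N n (V n w) w))).
  exact: (integrableZl measurableT _ i3).
apply: (@le_trans _ _ (\int[P n]_w (ramp x eps (PR n w (V n w)) +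
    eps^-1 * (PR n w (V n w) - rk N n (V n w) w)))).
  apply: le_Rintegral => //.
    exact: eq_integrable (integrableD measurableT i1 i4).
  by move=> w _; rewrite mulrC; apply: ramp_lip.
rewrite RintegralD// lerD2l RintegralZl// mulrC ler_wpM2r ?invr_ge0 ?(ltW eps0)//.
rewrite -lee_fin /Rintegral fineK; first exact: mean_gapV.
exact: integrable_fin_num measurableT _ i3.
Qed.

Let mean_rkV x eps N n : \int[P n]_w ramp x eps (rk N n (V n w) w) =
  n.+1%:R^-1 * \sum_(v < n.+1) \int[P n]_w ramp x eps (rk N n v w).
Proof.
rewrite {1}/Rintegral.
rewrite (uniform_vertex_mean (S := S n) (g := fun v w => ramp x eps (rk N n v
  w)))//.
- have ir v : (P n).-integrable setT (EFin \o (fun w => ramp x eps (rk N n v w))).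
    exact: integrable_ramp.
  rewrite (eq_bigr (fun v => (\int[P n]_w ramp x eps (rk N n v w))%:E)); last first.
    move=> v _; rewrite /Rintegral fineK//.
    exact: integrable_fin_num measurableT _ (ir v).
  by rewrite sumEFin.
- move=> v; apply: (@measurableT_comp _ _ _ _ _ _ (ramp x eps)).
    exact: measurable_ramp.
  exact: measurable_rk.
- by move=> v w; exact: ramp_ge0.
Qed.

(** The truncated ranks approximate the ranks uniformly in n, so that their
    asymptotics for each fixed N is all that has to be provided. *)
Lemma rank_representation :
  (forall N x eps, 0 < eps -> cvgn (fun n => n.+1%:R^-1 *
      \sum_(v < n.+1) \int[P n]_w ramp x eps (rk N n v w))) ->
  exists (d' : measure_display) (T' : measurableType d')
    (P' : probability T' R) (Z : {RV P' >-> R}),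
    [/\ forall w, 0 <= Z w, ('E_P'[Z] <= 1)%E,
      cvg_in_distribution P (fun n w => PR n w (V n w)) P' Z &
      forall x eps : R, 0 < eps ->
        \int[P n]_w ramp x eps (PR n w (V n w)) @[n --> \oo] -->
        \int[P']_w ramp x eps (Z w)].
Proof.
move=> cN.
have [||||d' [T' [P' [Z [Z0 EZ cZ]]]]] := @ramp_limit_representation R d T P
    (fun n w => PR n w (V n w)).
- exact: measurable_PRV.
- by move=> n w.
- exact: mean_PRV.
- move=> x eps eps0.
  apply: (@cvgn_uniform_approx _ _ (fun N n => \int[P n]_w ramp x eps (rk N n
    (V n w) w))
    (fun N => c ^+ N / eps)).
  + by move=> N; under eq_fun do rewrite mean_rkV; exact: cN.
  + by move=> N n; exact: ramp_gap.
  + rewrite -(mul0r eps^-1); apply: cvgMr_tmp; apply: cvg_expr.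
    by rewrite ger0_norm.
exists d', T', P', Z; split => //.
exact: cvg_ramps_in_distribution.
Qed.


Let lwG n w v := lwclass R (ord_mgraph (fun j i => e n j i w) (fun=> tt) v).
Let lwGCB n w v :=
  lwclass R (ord_mgraph (fun j i => e n j i w) (fun i => (C n i w, B n i w)) v).
Arguments lwG : clear implicits.
Arguments lwGCB : clear implicits.

Let mean01 n (f : 'I_n.+1 -> R) : (forall v, 0 <= f v <= 1) ->
  0 <= n.+1%:R^-1 * \sum_(v < n.+1) f v <= 1.
Proof.
move=> f01; apply/andP; split.
  by rewrite mulr_ge0// sumr_ge0// => v _; case/andP: (f01 v).
rewrite ler_pdivrMl// mulr1 -[leRHS]mulr1 -[X in _ <= X%:R * _](card_ord n.+1).
rewrite mulr_natl -sumr_const; apply: ler_sum => v _; by case/andP: (f01 v).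
Qed.

Let mean_ramp01 N x eps n : 0 <= n.+1%:R^-1 *
  \sum_(v < n.+1) \int[P n]_w ramp x eps (rk N n v w) <= 1.
Proof.
apply: mean01 => v; apply: Rintegral_le1 => [|w]; last by rewrite ramp_ge0 ramp_le1.
exact: (measurableT_comp (measurable_ramp x eps) (@measurable_rkT N n v)).
Qed.

(** The ramp of the truncated rank is a local function of the marked graph. *)
Let mean_rank_cvg_marked N x eps : lw_cvg_in_distribution P lwGCB ->
  cvgn (fun n => n.+1%:R^-1 *
      \sum_(v < n.+1) \int[P n]_w ramp x eps (rk N n v w)).
Proof.
move=> [mu cmu].
have cf := @marked_rank_continuous R N (ramp x eps).
have bf : bounded_fun (fun y : lwspace R (R * R)%type => ramp x eps
  (marked_rank N (lwrepr y))).
  exists 1; split; first exact: num_real.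
  by move=> M M1 y _; exact: le_trans (ramp_norm _ _ _) (ltW M1).
suff E : (fun n => (n.+1%:R^-1 *
      \sum_(v < n.+1) \int[P n]_w ramp x eps (rk N n v w))%:E) =
    (fun n => 'E_(P n)[fun w => root_mean (fun y => ramp x eps (marked_rank N
      (lwrepr y))) (lwGCB n w)])%E.
  by apply: (cvgn_EFin_bounded (mean_ramp01 N x eps)); rewrite E; exact: (cmu _
    cf bf).
apply/funext => n.
have ir v : (P n).-integrable setT (EFin \o (fun w => ramp x eps (rk N n v w))).
  exact: integrable_ramp.
rewrite -Rintegral_sumr// -expectation_Rintegral; last exact: integrable_sumr.
congr expectation; apply/funext => w; rewrite /root_mean; congr (_ * _).
by apply: eq_bigr => v _; rewrite marked_rank_ord.
Qed.

(** The test function f maps a graph to the quenched mean of any finite graph that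
    has the same neighborhood of the root.  The graph takes countably many values,
    coded by K, so that freezing it is a disintegration over K. *)
Let mean_rank_cvg_iid N x eps :
  iid_array P (fun n => C n) -> iid_array P (fun n => B n) ->
  (forall n, independent (P n) (sigmaC n) (sigmaB n)) ->
  (forall n, independent (P n) <<s sigmaC n `|` sigmaB n >> (sigmaG n)) ->
  lw_cvg_in_distribution P lwG ->
  cvgn (fun n => n.+1%:R^-1 *
      \sum_(v < n.+1) \int[P n]_w ramp x eps (rk N n v w)).
Proof.
move=> iidC iidB iCB iG [mu cmu].
pose q n g v := @quenched_mean R d T P C B (ramp x eps) N n g v.
have mr := measurable_ramp x eps.
have r01 y : 0 <= ramp x eps y <= 1 by rewrite ramp_ge0 ramp_le1.
have q01 n g v : 0 <= q n g v <= 1.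
  apply: Rintegral_le1 => // w; apply: (@measurableT_comp _ _ _ _ _ _ (ramp x
    eps)) => //.
  apply: (@measurable_pr_iter _ (T n) R n.+1 (fun j i _ => g j i)
    (fun i => C n i) (fun i => B n i)) => // i; exact: measurable_funP.
pose code := {n : nat & (('I_n.+1 -> 'I_n.+1 -> nat) * 'I_n.+1)%type}.
pose gr (k : code) := ord_mgraph (projT2 k).1 (fun=> tt) (projT2 k).2.
pose qc (k : code) := q (projT1 k) (projT2 k).1 (projT2 k).2.
have qloc (k l : code) : miso (nbhd N.+1 (gr k)) (nbhd N.+1 (gr l)) -> qc k = qc l.
  exact: (@quenched_mean_local R d T P C B iidC iidB iCB (ramp x eps) mr r01 N
    N.+1).
(* the value 0 is for graphs whose neighborhood occurs in no finite graph *)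
pose f (y : lwspace R unit) : R :=
  if pselect (exists k : code, miso (nbhd N.+1 (lwrepr y)) (nbhd N.+1 (gr k)))
    is left ex
  then qc (projT1 (cid ex)) else 0.
have fE y k : miso (nbhd N.+1 (lwrepr y)) (nbhd N.+1 (gr k)) -> f y = qc k.
  move=> yk; rewrite /f; case: pselect => [ex|[]]; last by exists k.
  apply: qloc; case: (cid ex) => l /= yl; exact: miso_trans (miso_sym yl) yk.
have f01 y : 0 <= f y <= 1.
  by rewrite /f; case: pselect => [ex|_]; [exact: q01|rewrite lexx ler01].
have cf : continuous f.
  apply: (@local_continuous _ _ _ N.+1) => // y z yz.
  rewrite /f; case: pselect => [ex|nex]; case: pselect => [ex'|nex'] //.
  - apply: qloc; case: (cid ex) => k /= yk; case: (cid ex') => l /= zl.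
    exact: miso_trans (miso_trans (miso_sym yk) yz) zl.
  - by case: nex'; case: ex => k yk; exists k; exact: miso_trans (miso_sym yz) yk.
  - by case: nex; case: ex' => k zk; exists k; exact: miso_trans yz zk.
have bf : bounded_fun f.
  exists 1; split; first exact: num_real.
  move=> M M1 y _; rewrite /= ger0_norm; first by case/andP: (f01 y) => _
    /le_trans; apply; exact: ltW.
  by case/andP: (f01 y).
suff E : (fun n => (n.+1%:R^-1 *
      \sum_(v < n.+1) \int[P n]_w ramp x eps (rk N n v w))%:E) =
    (fun n => 'E_(P n)[fun w => root_mean f (lwG n w)])%E.
  by apply: (cvgn_EFin_bounded (mean_ramp01 N x eps)); rewrite E; exact: (cmu _
    cf bf).
apply/funext => n.
have flw w v : f (lwG n w v) = q n (fun j i => e n j i w) v.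
  apply: (fE _ (existT _ n (fun j i => e n j i w, v) : code)).
  exact: lwrepr_nbhd.
pose gT : countType := {ffun 'I_n.+1 * 'I_n.+1 -> nat}.
pose mat w : gT := [ffun ji => e n ji.1 ji.2 w].
pose K w := choice.pickle (mat w).
pose dec (k : nat) (j i : 'I_n.+1) : nat :=
  if choice.unpickle k is Some g then (g : gT) (j, i) else 0%N.
have decK w : dec (K w) = (fun j i => e n j i w).
  by apply/funext => j; apply/funext => i; rewrite /dec /K choice.pickleK ffunE.
have KG k : sigmaG n (K @^-1` [set k]).
  have [[w0 w0k]|none] := pselect (exists w, K w = k); last first.
    rewrite (_ : _ @^-1` _ = set0); first exact: sigma_algebra0.
    by rewrite -subset0 => w /= wk; apply: none; exists w.
  rewrite (_ : _ @^-1` _ = \bigcap_(ji in [set: 'I_n.+1 * 'I_n.+1])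
      (e n ji.1 ji.2 @^-1` [set e n ji.1 ji.2 w0])).
    apply: (@fin_bigcap_measurable _ (g_sigma_algebraType
      (\bigcup_ji preimage_set_system [set: T n]
        (fun w => e n ji.1 ji.2 w) measurable))) => // ji _.
    exact (@sigma_rv_preimage _ (T n) _ _ _ (fun ji w => e n ji.1 ji.2 w) ji
      [set e n ji.1 ji.2 w0] I).
  apply/seteqP; split => w /=.
    rewrite -w0k => /(pcan_inj (@choice.pickleK _)) /ffunP ww0 ji _.
    by have := ww0 ji; rewrite !ffunE.
  move=> ww0; rewrite -w0k /K; congr choice.pickle; apply/ffunP => ji.
  by rewrite !ffunE; exact: ww0.
have mK k : measurable (K @^-1` [set k]).
  apply: (sigma_rv_measurable _ (KG k)) => ji; exact: measurable_funP.
have key v : \int[P n]_w q n (fun j i => e n j i w) v = \int[P n]_w ramp x eps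
  (rk N n v w).
  rewrite /Rintegral; congr fine; apply/esym.
  pose g k w := ramp x eps (pr_iter (dec k) (fun i => C n i w) (fun i => B n i
    w) N v).
  transitivity (\int[P n]_w (g (K w) w)%:E)%E.
    by apply: eq_integral => w _; rewrite /g decK.
  have g01 k w : 0 <= g k w <= 1 by exact: r01.
  have Sm' : sigmaC n `|` sigmaB n `<=` measurable.
    by move=> D [|]; apply: sigma_rv_measurable => i; exact: measurable_funP.
  have iK k D : <<s sigmaC n `|` sigmaB n >> D ->
      P n (K @^-1` [set k] `&` D) = (P n (K @^-1` [set k]) * P n D)%E.
    by move=> SD; rewrite setIC muleC; exact: iG.
  have mg k : measurable_fun [set: g_sigma_algebraType (sigmaC n `|` sigmaB n)]
    (g k).
    apply: (@measurableT_comp _ _ _ _ _ _ (ramp x eps)) => //.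
    apply: (@measurable_pr_iter _ (g_sigma_algebraType (sigmaC n `|` sigmaB n))
      R n.+1
      (fun j i _ => dec k j i) (fun i => C n i) (fun i => B n i)) => //.
    + move=> i _ A mA; rewrite setTI; apply: sub_sigma_algebra; left.
      exact (@sigma_rv_preimage _ (T n) _ _ _ (fun i => C n i) i A mA).
    + move=> i _ A mA; rewrite setTI; apply: sub_sigma_algebra; right.
      exact (@sigma_rv_preimage _ (T n) _ _ _ (fun i => B n i) i A mA).
  apply: (etrans (@indep_disintegration _ (T n) R (P n) (sigmaC n `|` sigmaB n)
    K g Sm' mK iK mg g01)).
  by apply: eq_integral => w _; rewrite /q /quenched_mean -decK.
have iq v : (P n).-integrable setT (EFin \o (fun w => q n (fun j i => e n j i
  w) v)).
  apply: (@bounded_integrable _ _ _ _ _ 1) => [|w]; last first.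
    by rewrite ger0_norm; [case/andP: (q01 n (fun j i => e n j i w) v)
      |case/andP: (q01 n (fun j i => e n j i w) v)].
  under eq_fun do rewrite -decK.
  exact: (@measurable_natfun _ _ _ R K (fun k => q n (dec k) v)
    (measurable_countable_fibers mK)).
rewrite (eq_bigr _ (fun v _ => esym (key v))).
rewrite -Rintegral_sumr// -expectation_Rintegral; last exact: integrable_sumr.
congr expectation; apply/funext => w; rewrite /root_mean; congr (_ * _).
by apply: eq_bigr => v _; rewrite flw.
Qed.

Let mean_rank_in_probability_marked N x eps : lw_cvg_in_probability P lwGCB ->
  exists b, cvg_in_probability P
    (fun n w => n.+1%:R^-1 * \sum_(v < n.+1) ramp x eps (rk N n v w)) b.
Proof.
move=> [mu cmu]; eexists.
have cf := @marked_rank_continuous R N (ramp x eps).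
have bf : bounded_fun (fun y : lwspace R (R * R)%type => ramp x eps
  (marked_rank N (lwrepr y))).
  exists 1; split; first exact: num_real.
  by move=> M M1 y _; exact: le_trans (ramp_norm _ _ _) (ltW M1).
apply: eq_cvg_in_probability (cmu _ cf bf) => n w.
rewrite /root_mean; congr (_ * _).
by apply: eq_bigr => v _; rewrite marked_rank_ord.
Qed.

(** The error between the empirical means of ranks and truncated ranks is
    controlled in probability by its mean, with N chosen after the required
    precisions a and eta. *)
Let mean_rank_in_probability x eps l : 0 < eps ->
  (forall N, exists b, cvg_in_probability P
    (fun n w => n.+1%:R^-1 * \sum_(v < n.+1) ramp x eps (rk N n v w)) b) ->
  \int[P n]_w ramp x eps (PR n w (V n w)) @[n --> \oo] --> l ->
  cvg_in_probability P
    (fun n w => n.+1%:R^-1 * \sum_(v < n.+1) ramp x eps (PR n w v)) l.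
Proof.
move=> eps0 cN cl.
have mPR n : measurable_fun [set: T n]
    (fun w => n.+1%:R^-1 * \sum_(v < n.+1) ramp x eps (PR n w v)).
  apply: measurable_funM => //; apply: measurable_sum => v.
  exact: (measurableT_comp (measurable_ramp x eps) (@measurable_PRT n v)).
have mrk N n : measurable_fun [set: T n]
    (fun w => n.+1%:R^-1 * \sum_(v < n.+1) ramp x eps (rk N n v w)).
  apply: measurable_funM => //; apply: measurable_sum => v.
  exact: (measurableT_comp (measurable_ramp x eps) (@measurable_rkT N n v)).
pose gap N n w := n.+1%:R^-1 * \sum_(v < n.+1) (PR n w v - rk N n v w).
have mgap N n : measurable_fun [set: T n] (gap N n).
  apply: measurable_funM => //; apply: measurable_sum => v.
  exact: measurable_funB.
have gap0 N n w : 0 <= gap N n w.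
  by rewrite mulr_ge0// sumr_ge0// => v _; rewrite subr_ge0.
have gap_mean N n : (\int[P n]_w (gap N n w)%:E <= (c ^+ N)%:E)%E.
  apply: le_trans (mean_gap N n).
  rewrite -ge0_integral_sum//; last 2 first.
  - by move=> v; apply/measurable_EFinP; exact: measurable_funB.
  - by move=> v w _; rewrite lee_fin subr_ge0.
  rewrite -ge0_integralZl//; last 2 first.
  - by apply: emeasurable_sum => v; apply/measurable_EFinP; exact: measurable_funB.
  - by move=> w _; apply: sume_ge0 => v _; rewrite lee_fin subr_ge0.
  rewrite le_eqVlt; apply/orP; left; apply/eqP; apply: eq_integral => w _.
  by rewrite sumEFin -EFinM.
have gap_ramp N n w :
    `|n.+1%:R^-1 * \sum_(v < n.+1) ramp x eps (PR n w v) -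
      n.+1%:R^-1 * \sum_(v < n.+1) ramp x eps (rk N n v w)| <= gap N n w / eps.
  rewrite distrC -mulrBr -sumrB ger0_norm; last first.
    by rewrite mulr_ge0// sumr_ge0// => v _; rewrite subr_ge0; exact: ramp_anti.
  rewrite /gap -mulrA ler_wpM2l// mulr_suml; apply: ler_sum => v _.
  by rewrite lerBlDl; apply: ramp_lip.
apply/(@in_probabilityP R d T P _ l mPR) => a eta a0 eta0.
have a4 : 0 < a / 4 by rewrite divr_gt0.
have ea4 : 0 < a / 4 * eps by rewrite mulr_gt0.
pose kap := Num.min (a / 4 * eps) (eta / 2 * (a / 4 * eps)).
have kap0 : 0 < kap by rewrite lt_min ea4 mulr_gt0// divr_gt0.
have cc : c ^+ N @[N --> \oo] --> (0 : R) by apply: cvg_expr; rewrite ger0_norm.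
have [N _ /(_ N (leqnn N)) cNk] := cvgr_lt _ cc _ kap0.
have {cNk} [cN1 cN2] : c ^+ N < a / 4 * eps /\ c ^+ N < eta / 2 * (a / 4 * eps).
  by apply/andP; rewrite -lt_min.
have [b cb] := cN N.
have lb : `|l - b| <= a / 4.
  have cm : \int[P n]_w ramp x eps (rk N n (V n w) w) @[n --> \oo] --> b.
    under eq_fun do rewrite mean_rkV.
    have ir n v : (P n).-integrable setT (EFin \o (fun w => ramp x eps (rk N n
      v w))).
      exact: integrable_ramp.
    under eq_fun do rewrite -Rintegral_sumr//.
    apply: (@in_probability_mean R d T P _ b (mrk N) _ cb) => n w.
    by apply: mean01 => v; rewrite ramp_ge0 ramp_le1.
  have cd : `|\int[P n]_w ramp x eps (PR n w (V n w)) -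
      \int[P n]_w ramp x eps (rk N n (V n w) w)| @[n --> \oo] --> `|l - b|.
    by apply: cvg_norm; apply: cvgB.
  rewrite -(cvg_lim (@Rhausdorff R) cd); apply: limr_le.
    by apply/cvg_ex; exists `|l - b|.
  apply: nearW => n; apply: le_trans (ramp_gap x N n eps0) _.
  by rewrite ler_pdivrMr// ltW.
have eta2 : 0 < eta / 2 by rewrite divr_gt0.
move/(@in_probabilityP R d T P _ b (mrk N)) : cb => /(_ _ _ a4 eta2).
apply: filterS => n Pn.
set E1 := [set w | _] in Pn; set E0 := [set w | _].
pose E2 := [set w | a / 4 * eps < `|gap N n w - 0|].
have mE1 : measurable E1 by exact: measurable_deviation.
have mE2 : measurable E2 by exact: measurable_deviation.
have mE0 : measurable E0 by exact: measurable_deviation.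
have PE2 : (P n E2 <= (eta / 2)%:E)%E.
  apply: le_trans (mean_deviation (mgap N n) (gap0 N n) ea4 (gap_mean N n)) _.
  by rewrite lee_fin ler_pdivrMr// ltW.
have sub : E0 `<=` E1 `|` E2.
  move=> w E0w; apply: contrapT => /not_orP[/negP nE1 /negP nE2].
  move: nE1; rewrite /E1 /= -leNgt => nE1.
  move: nE2; rewrite /E2 /= -leNgt subr0 ger0_norm// => nE2.
  have gap4 : gap N n w / eps <= a / 4 by rewrite ler_pdivrMr.
  have h := le_trans (gap_ramp N n w) gap4; rewrite distrC in lb.
  move: E0w; rewrite /E0 /= ltNge => /negP; apply.
  apply: (le_trans (ler_distD _ _ _) (le_trans (lerD h
    (le_trans (ler_distD _ _ _) (lerD nE1 lb))) _)).
  by lra.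
rewrite (splitr eta) EFinD; apply: le_trans (leeD Pn PE2).
apply: (le_trans _ (@measureU2 _ _ _ (P n) _ _ mE1 mE2)).
by apply: le_measure => //; rewrite inE//; exact: measurableU.
Qed.

(** The indicator of ]r, +oo[ lies between 1 - ramp r delta and
    1 - ramp (r - delta) delta, whose means under Z are both within a/2 of
    P(Z > r) for delta small, as r is not an atom of Z. *)
Lemma rank_tail_in_probability :
  lw_cvg_in_probability P lwGCB ->
  exists (d' : measure_display) (T' : measurableType d')
    (P' : probability T' R) (Z : {RV P' >-> R}),
    [/\ forall w, 0 <= Z w, ('E_P'[Z] <= 1)%E
      & forall r : R, 0 < r -> P' [set w | Z w = r] = 0%E ->
        cvg_in_probability P
          (fun n w => n.+1%:R^-1 * \sum_(i < n.+1) (r < PR n w i)%R%:R)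
          (fine (P' [set w | r < Z w]))].
Proof.
move=> cG.
have cb N x eps := mean_rank_in_probability_marked N x eps cG.
have [N x eps eps0|d' [T' [P' [Z [Z0 EZ _ cZ]]]]] := rank_representation.
  have [b cNb] := cb N x eps.
  have ir n v : (P n).-integrable setT (EFin \o (fun w => ramp x eps (rk N n v w))).
    exact: integrable_ramp.
  have mrk n : measurable_fun [set: T n]
      (fun w => n.+1%:R^-1 * \sum_(v < n.+1) ramp x eps (rk N n v w)).
    apply: measurable_funM => //; apply: measurable_sum => v.
    exact: (measurableT_comp (measurable_ramp x eps) (@measurable_rkT N n v)).
  under eq_fun do rewrite -Rintegral_sumr//.
  apply/cvg_ex; exists b.
  apply: (@in_probability_mean R d T P _ b mrk _ cNb) => n w.
  by apply: mean01 => v; rewrite ramp_ge0 ramp_le1.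
exists d', T', P', Z; split => // r r0 Pr.
have mZ : measurable_fun [set: T'] Z by exact: measurable_funP.
have cm x eps (eps0 : 0 < eps) := mean_rank_in_probability eps0 (fun N => cb N
  x eps) (cZ x eps eps0).
have mPR x eps n : measurable_fun [set: T n]
    (fun w => n.+1%:R^-1 * \sum_(v < n.+1) ramp x eps (PR n w v)).
  apply: measurable_funM => //; apply: measurable_sum => v.
  exact: (measurableT_comp (measurable_ramp x eps) (@measurable_PRT n v)).
pose F x := fine (P' [set w | Z w <= x]).
have mle x : measurable [set w | Z w <= x] by exact: measurable_le_set.
have pF : fine (P' [set w | r < Z w]) = 1 - F r.
  rewrite (_ : [set w | r < Z w] = ~` [set w | Z w <= r]); last first.
    apply/seteqP; split => w /=; first by rewrite ltNge => /negP.
    by move/negP; rewrite -ltNge.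
  by rewrite probability_setC// fineB// fin_num_measure.
have mQ n : measurable_fun [set: T n]
    (fun w => n.+1%:R^-1 * \sum_(i < n.+1) (r < PR n w i)%R%:R : R).
  apply: measurable_funM => //; apply: measurable_sum => v.
  rewrite (_ : (fun w => _) = \1_[set w | r < PR n w v]); last first.
    by apply/funext => w; rewrite indicE; congr ((nat_of_bool _)%:R);
      apply/idP/idP; rewrite inE.
  apply: measurable_indic.
  rewrite (_ : [set w | _] = ~` [set w | PR n w v <= r]); last first.
    apply/seteqP; split => w /=; first by rewrite ltNge => /negP.
    by move/negP; rewrite -ltNge.
  by apply: measurableC; exact: measurable_le_set.
apply/(@in_probabilityP R d T P _ _ mQ) => a eta a0 eta0; rewrite pF.
have a2 : 0 < a / 2 by rewrite divr_gt0.
have eta2 : 0 < eta / 2 by rewrite divr_gt0.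
have [delta delta0 jump] := cdf_local_jump mZ Pr a2.
have Fnd x y : x <= y -> F x <= F y.
  move=> xy; apply: fine_le; rewrite ?fin_num_measure//.
  apply: le_measure; rewrite ?inE// => w /= Zx; exact: le_trans xy.
have Fr1 : F (r - delta) <= F r by apply: Fnd; rewrite gerBl ltW.
have Fr2 : F r <= F (r + delta) by apply: Fnd; rewrite lerDl ltW.
have /andP[_ L1] := ramp_mean_cdf P' r mZ delta0.
have /andP[L2 _] := ramp_mean_cdf P' (r - delta) mZ delta0.
have c1' := (@in_probabilityP R d T P _ _ (mPR r delta)).1 (cm r delta delta0)
  _ _ a2 eta2.
have c2' := (@in_probabilityP R d T P _ _ (mPR (r - delta) delta)).1 (cm (r -
  delta) delta delta0) _ _ a2 eta2.
apply: filterS2 c1' c2' => n P1 P2.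
set E1 := [set w | _] in P1; set E2 := [set w | _] in P2; set E0 := [set w | _].
have mE1 : measurable E1 by apply: measurable_deviation; exact: mPR.
have mE2 : measurable E2 by apply: measurable_deviation; exact: mPR.
have mE0 : measurable E0 by exact: measurable_deviation.
have sub : E0 `<=` E1 `|` E2.
  move=> w E0w; apply: contrapT => /not_orP[/negP nE1 /negP nE2].
  move: nE1; rewrite /E1 /= -leNgt ler_norml => /andP[_ nE1].
  move: nE2; rewrite /E2 /= -leNgt ler_norml => /andP[nE2 _].
  have sumB f : n.+1%:R^-1 * \sum_(v < n.+1) (1 - f v) =
      1 - n.+1%:R^-1 * \sum_(v < n.+1) f v :> R.
    have hn : (n.+1%:R : R) != 0 by rewrite pnatr_eq0.
    by rewrite sumrB mulrBr sumr_const card_ord mulVf.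
  have Q1 : 1 - n.+1%:R^-1 * \sum_(v < n.+1) ramp r delta (PR n w v) <=
      n.+1%:R^-1 * \sum_(i < n.+1) (r < PR n w i)%R%:R.
    rewrite -sumB ler_wpM2l//; apply: ler_sum => v _.
    by have [rv|vr] := ltP r; [rewrite gerBl ramp_ge0|rewrite ramp1// subrr].
  have Q2 : n.+1%:R^-1 * \sum_(i < n.+1) (r < PR n w i)%R%:R <=
      1 - n.+1%:R^-1 * \sum_(v < n.+1) ramp (r - delta) delta (PR n w v).
    rewrite -sumB ler_wpM2l//; apply: ler_sum => v _.
    have [rv|vr] := ltP r; last by rewrite subr_ge0 ramp_le1.
    by rewrite ramp0 ?subr0// subrK ltW.
  move: E0w; rewrite /E0 /= ltNge => /negP; apply.
  move: (n.+1%:R^-1 * _) Q1 Q2 nE1 nE2 => Q.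
  move: (n.+1%:R^-1 * _) => q1; move: (n.+1%:R^-1 * _) => q2 Q1 Q2 nE1 nE2.
  by rewrite ler_norml; apply/andP; split; rewrite /F in Fr1 Fr2 *; lra.
rewrite (splitr eta) EFinD; apply: le_trans (leeD P1 P2).
apply: (le_trans _ (@measureU2 _ _ _ (P n) _ _ mE1 mE2)).
by apply: le_measure => //; rewrite inE//; exact: measurableU.
Qed.

Lemma rank_cvg_marked : lw_cvg_in_distribution P lwGCB ->
  exists (d' : measure_display) (T' : measurableType d')
    (P' : probability T' R) (Z : {RV P' >-> R}),
    [/\ forall w, 0 <= Z w, ('E_P'[Z] <= 1)%E
      & cvg_in_distribution P (fun n w => PR n w (V n w)) P' Z].
Proof.
move=> cG.
have [N x eps eps0|d' [T' [P' [Z [Z0 EZ cZ _]]]]] := rank_representation.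
  exact: mean_rank_cvg_marked.
by exists d', T', P', Z.
Qed.

Lemma rank_cvg_iid :
  iid_array P (fun n => C n) -> iid_array P (fun n => B n) ->
  (forall n, independent (P n) (sigmaC n) (sigmaB n)) ->
  (forall n, independent (P n) <<s sigmaC n `|` sigmaB n >> (sigmaG n)) ->
  lw_cvg_in_distribution P lwG ->
  exists (d' : measure_display) (T' : measurableType d')
    (P' : probability T' R) (Z : {RV P' >-> R}),
    cvg_in_distribution P (fun n w => PR n w (V n w)) P' Z.
Proof.
move=> iidC iidB iCB iG cG.
have [N x eps eps0|d' [T' [P' [Z [Z0 EZ cZ _]]]]] := rank_representation.
  exact: mean_rank_cvg_iid.
by exists d', T', P', Z.
Qed.

End pagerank_of_random_graphs.

Theorem theorem5p1 (R : realType)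
  (d : nat -> measure_display) (T : forall n, measurableType (d n))
  (P : forall n, probability (T n) R)
  (e : forall n, 'I_n.+1 -> 'I_n.+1 -> {RV (P n) >-> nat})
  (C B : forall n, 'I_n.+1 -> {RV (P n) >-> R})
  (V : forall n, T n -> 'I_n.+1)
  (PR : forall n, T n -> 'I_n.+1 -> R)
  (c : R) :
  let sigmaG n := sigma_rv (fun ji => e n ji.1 ji.2) in
  let sigmaC n := sigma_rv (C n) in
  let sigmaB n := sigma_rv (B n) in
  let PRV n w := PR n w (V n w) in
  let lwG n w v :=
    lwclass R (ord_mgraph (fun j i => e n j i w) (fun=> tt) v) in
  let lwGCB n w v :=
    lwclass R (ord_mgraph (fun j i => e n j i w)
                          (fun i => (C n i w, B n i w)) v) in
  c < 1 ->
  (forall n i w, 0 <= C n i w <= c) ->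
  (forall n i w, 0 <= B n i w) ->
  (forall n i, 'E_(P n)[B n i] = (1 - c)%:E)%E ->
  (forall n, independent (P n) (sigmaB n) (sigmaG n)) ->
  (forall n w, is_pagerank (fun j i => e n j i w)
                 (fun i => C n i w) (fun i => B n i w) (PR n w)) ->
  (forall n v, measurable (V n @^-1` [set v])) ->
  (forall n v, P n (V n @^-1` [set v]) = (n.+1%:R^-1)%:E) ->
  (forall n, independent (P n)
     (preimage_set_system [set: T n] (V n) [set: set 'I_n.+1])
     <<s sigmaG n `|` sigmaC n `|` sigmaB n >>) ->
  [/\
    iid_array P C -> iid_array P B ->
    (forall n, independent (P n) (sigmaC n) (sigmaB n)) ->
    (forall n, independent (P n)
       <<s sigmaC n `|` sigmaB n >> (sigmaG n)) ->
    lw_cvg_in_distribution P lwG ->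
    exists (d' : measure_display) (T' : measurableType d')
      (P' : probability T' R) (R0 : {RV P' >-> R}),
      cvg_in_distribution P PRV P' R0,

    (forall n i, countable (range (C n i))) ->
    (forall n i, countable (range (B n i))) ->
    lw_cvg_in_distribution P lwGCB ->
    exists (d' : measure_display) (T' : measurableType d')
      (P' : probability T' R) (R0 : {RV P' >-> R}),
      [/\ forall w, 0 <= R0 w, ('E_P'[R0] <= 1)%E
        & cvg_in_distribution P PRV P' R0]
  & (forall n i, countable (range (C n i))) ->
    (forall n i, countable (range (B n i))) ->
    lw_cvg_in_probability P lwGCB ->
    exists (d' : measure_display) (T' : measurableType d')
      (P' : probability T' R) (R0 : {RV P' >-> R}),
      [/\ forall w, 0 <= R0 w, ('E_P'[R0] <= 1)%E
        & forall r : R, 0 < r -> P' [set w | R0 w = r] = 0%E ->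
          cvg_in_probability P
            (fun n w => n.+1%:R^-1 * \sum_(i < n.+1) (r < PR n w i)%R%:R)
            (fine (P' [set w | r < R0 w]))]].
Proof.
move=> sigmaG sigmaC sigmaB PRV lwG lwGCB c1 Cc B0 EB _ PRP mV PV iV.
split.
- exact: (@rank_cvg_iid R d T P e C B V PR c c1 Cc B0 EB PRP mV PV iV).
- move=> _ _.
  exact: (@rank_cvg_marked R d T P e C B V PR c c1 Cc B0 EB PRP mV PV iV).
- move=> _ _.
  exact: (@rank_tail_in_probability R d T P e C B V PR c c1 Cc B0 EB PRP mV PV iV).
Qed.
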